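(* Let $G$ be the group of automorphisms of the binary rooted tree $T=\{x,y\}^*$ generated by $a=\langle\langle b,1\rangle\rangle(x,y)$ and $b=\langle\langle a,1\rangle\rangle$. For $n\ge0$ let $\pi_n$ be the permutation representation of $G$ on the $n$th layer $T_n$ of $T$, and let $$Q_n(\lambda,\mu,\nu)=\det\left(\lambda+\mu\big(\pi_n(a)+\pi_n(a^{-1})\big)+\nu\big(\pi_n(b)+\pi_n(b^{-1})\big)\right).$$ Define the polynomial mapping $F:\mathbb R^3\to\mathbb R^3$ by $$F(\lambda,\mu,\nu)=(\lambda^2+2\lambda\nu-2\mu^2,\ \lambda\nu+2\nu^2,\ -\mu^2).$$ Then $Q_n$ is given by $$Q_0(\lambda,\mu,\nu)=\lambda+2\mu+2\nu,$$ $$Q_1(\lambda,\mu,\nu)=Q_0(\lambda,\mu,\nu)\cdot(\lambda-2\mu+2\nu),$$ and, for $n\ge1$, $$Q_{n+1}(\lambda,\mu,\nu)=Q_n(F(\lambda,\mu,\nu)).$$ Define $K$ as the closure of the set of all backwards $F$-iterates of $\{Q_1=0\}$, i.e. the closure in $\mathbb R^3$ of $\bigcup_{n\ge0}F^{-n}(\{Q_1=0\})$. Then the spectrum of $\pi$, the natural representation of $G$ on $L^2(\partial T)$, is the intersection of $\{\mu=\nu=-\tfrac14\}$ with $K$ (the line $\{\mu=\nu=-\frac14\}$ being identified with $\mathbb R$ by the coordinate $\lambda$).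
   Context: The vertices of $T$ are the words in $\{x,y\}^*$, and $T_n$ is the set of words of length $n$. Automorphisms act on the right; $\langle\langle g_x,g_y\rangle\rangle\pi$, with $\pi$ a permutation of $\{x,y\}$, sends $iw$ to $i^{\pi}\,w^{g_i}$ for $i\in\{x,y\}$ and any word $w$ ($\pi$ omitted if trivial). Thus $(xw)^a=y\,w^b$, $(yw)^a=x\,w$, $(xw)^b=x\,w^a$, $(yw)^b=y\,w$. This $G$ is the iterated monodromy group of $z^2-1$. The representation $\pi_n$ is by $2^n\times2^n$ permutation matrices, and in $Q_n$ the scalar $\lambda$ stands for $\lambda$ times the identity matrix. $\partial T$ is the boundary of $T$ (infinite words over $\{x,y\}$) with its uniform probability measure, and $\pi$ is the unitary representation of $G$ on $L^2(\partial T)$ induced by the action on $\partial T$. For a unitary representation $\pi$ of a group with finite generating set $S$ on a Hilbert space $\mathcal H$, $\mathrm{spec}(\pi)=\frac1{|S|}\mathrm{spec}_{B(\mathcal H)}\big(\sum_{s\in S}\pi(s)\big)$; here $S=\{a,a^{-1},b,b^{-1}\}$. *)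

(* Defs.v *)
From HB Require Import structures.
From mathcomp Require Import all_boot all_order all_algebra ring_quotient.
From mathcomp Require Import all_classical all_reals all_analysis.
From mathcomp Require Import measurable_realfun complex.

Set Implicit Arguments.
Unset Strict Implicit.
Unset Printing Implicit Defensive.

Import Order.TTheory GRing.Theory Num.Theory.
Import numFieldNormedType.Exports.

Local Open Scope classical_set_scope.
Local Open Scope ring_scope.

(** The two letters of the alphabet {x, y} *)
Definition letter := bool.
Notation lx := false (only parsing).
Notation ly := true (only parsing).
Definition word := seq letter.

Record tree_aut := TreeAut {
  aut_fun :> word -> word;
  aut_inv : word -> word;
  aut_funK : cancel aut_fun aut_inv;
  aut_invK : cancel aut_inv aut_fun;
  size_aut : forall w, size (aut_fun w) = size w;
  prefix_aut : forall u v, prefix u v -> prefix (aut_fun u) (aut_fun v) }.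

Lemma tree_aut_ext (g h : tree_aut) : g =1 h -> g = h.
Proof.
case: g h => [g g' gK g'K sg pg] [h h' hK h'K sh ph] /= /funext gh.
rewrite -{}gh in hK h'K sh ph *.
have e : g' = h' by apply/funext => w; rewrite -{1}(h'K w) gK.
rewrite -{}e in hK h'K *.
by congr TreeAut; exact: Prop_irrelevance.
Qed.

Lemma take_prefix n (w : word) : prefix (take n w) w.
Proof. by rewrite -{2}(cat_take_drop n w) prefix_prefix. Qed.

Lemma aut_take (g : tree_aut) n w : g (take n w) = take n (g w).
Proof.
have := prefix_aut g (take_prefix n w); rewrite prefixE size_aut => /eqP <-.
have [nw|nw] := leqP n (size w); first by rewrite size_takel.
by rewrite !take_oversize// ?size_aut// ltnW.
Qed.
HB.instance Definition _ := gen_eqMixin tree_aut.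
HB.instance Definition _ := gen_choiceMixin tree_aut.

Definition aut1 : tree_aut :=
  @TreeAut id id (fun=> erefl) (fun=> erefl) (fun=> erefl) (fun _ _ => id).

Lemma size_autV (g : tree_aut) w : size (aut_inv g w) = size w.
Proof. by rewrite -(size_aut g) aut_invK. Qed.

Lemma prefix_autV (g : tree_aut) u v :
  prefix u v -> prefix (aut_inv g u) (aut_inv g v).
Proof.
rewrite prefixE => /eqP uv.
suff -> : aut_inv g u = take (size u) (aut_inv g v) by exact: take_prefix.
by apply: (can_inj (aut_funK g)); rewrite aut_take !aut_invK uv.
Qed.

Definition autV (g : tree_aut) : tree_aut :=
  TreeAut (aut_invK g) (aut_funK g) (size_autV g) (@prefix_autV g).

Lemma size_autM (g h : tree_aut) w : size (h (g w)) = size w.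
Proof. by rewrite !size_aut. Qed.

Lemma prefix_autM (g h : tree_aut) u v :
  prefix u v -> prefix (h (g u)) (h (g v)).
Proof. by move=> uv; do 2!apply: prefix_aut. Qed.

Definition autM (g h : tree_aut) : tree_aut :=
  TreeAut (can_comp (aut_funK h) (aut_funK g))
    (can_comp (aut_invK g) (aut_invK h)) (size_autM g h) (@prefix_autM g h).

Lemma autMA : associative autM.
Proof. by move=> f g h; apply: tree_aut_ext. Qed.
Lemma autM1g : left_id aut1 autM.
Proof. by move=> g; apply: tree_aut_ext. Qed.
Lemma autMg1 : right_id aut1 autM.
Proof. by move=> g; apply: tree_aut_ext. Qed.
Lemma autMVg : left_inverse aut1 autV autM.
Proof. by move=> g; apply: tree_aut_ext => w /=; rewrite aut_invK. Qed.
Lemma autMgV : right_inverse aut1 autV autM.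
Proof. by move=> g; apply: tree_aut_ext => w /=; rewrite aut_funK. Qed.

(** Automorphisms act on the right: [g * h] is [g] followed by [h]. *)
HB.instance Definition _ :=
  isGroup.Build tree_aut autMA autM1g autMg1 autMVg autMgV.

(** [a = <<b, 1>>(x,y)] and [b = <<a, 1>>] *)
Fixpoint a_fun (w : word) : word :=
  match w with
  | [::] => [::]
  | lx :: w => ly :: b_fun w
  | ly :: w => lx :: w
  end
with b_fun (w : word) : word :=
  match w with
  | [::] => [::]
  | lx :: w => lx :: a_fun w
  | ly :: w => ly :: w
  end.

Fixpoint a_inv (w : word) : word :=
  match w with
  | [::] => [::]
  | ly :: w => lx :: b_inv w
  | lx :: w => ly :: w
  end
with b_inv (w : word) : word :=
  match w with
  | [::] => [::]
  | lx :: w => lx :: a_inv w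
  | ly :: w => ly :: w
  end.

Lemma ab_funK : cancel a_fun a_inv /\ cancel b_fun b_inv.
Proof.
suff H w : a_inv (a_fun w) = w /\ b_inv (b_fun w) = w.
  by split=> w; case: (H w).
by elim: w => [//|[] w [aK bK]] /=; rewrite ?aK ?bK.
Qed.

Lemma ab_invK : cancel a_inv a_fun /\ cancel b_inv b_fun.
Proof.
suff H w : a_fun (a_inv w) = w /\ b_fun (b_inv w) = w.
  by split=> w; case: (H w).
by elim: w => [//|[] w [aK bK]] /=; rewrite ?aK ?bK.
Qed.

Lemma ab_size w : size (a_fun w) = size w /\ size (b_fun w) = size w.
Proof. by elim: w => [//|[] w [sa sb]] /=; rewrite ?sa ?sb. Qed.

Lemma ab_prefix u v : prefix u v ->
  prefix (a_fun u) (a_fun v) /\ prefix (b_fun u) (b_fun v).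
Proof. by elim: u v => [//|[] u IH] [|[] v]//= /IH[]. Qed.

Definition aut_a : tree_aut := TreeAut ab_funK.1 ab_invK.1
  (fun w => (ab_size w).1) (fun u v uv => (ab_prefix uv).1).
Definition aut_b : tree_aut := TreeAut ab_funK.2 ab_invK.2
  (fun w => (ab_size w).2) (fun u v uv => (ab_prefix uv).2).

Inductive generated_ab : tree_aut -> Prop :=
| Gen_a : generated_ab aut_a
| Gen_b : generated_ab aut_b
| Gen_1 : generated_ab 1%g
| Gen_div g h : generated_ab g -> generated_ab h -> generated_ab (g / h)%g.

Definition in_basilica : {pred tree_aut} := [pred g | `[< generated_ab g >]].

Lemma in_basilica_group_closed : group_closed in_basilica.
Proof.
split; first exact/asboolP/Gen_1.
by move=> g h /asboolP gG /asboolP hG; apply/asboolP; exact: Gen_div.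
Qed.

Definition basilica := {g : tree_aut | g \in in_basilica}.
HB.instance Definition _ := [isSub of basilica for @sval _ _].
HB.instance Definition _ := [Choice of basilica by <:].
HB.instance Definition _ :=
  SubChoice_isSubGroup.Build tree_aut in_basilica basilica in_basilica_group_closed.

Definition gen_a : basilica := exist _ aut_a (asboolT Gen_a).
Definition gen_b : basilica := exist _ aut_b (asboolT Gen_b).

Definition gens : seq basilica :=
  [:: gen_a; gen_a^-1; gen_b; gen_b^-1]%g.

Lemma uniq_gens : uniq gens.
Proof.
apply: (@map_uniq _ _ (fun g : basilica => (val g : tree_aut) [:: lx; lx; lx; lx])).
by [].
Qed.

Definition layer_act n (g : tree_aut) (w : n.-tuple letter) : n.-tuple letter :=
  @Tuple n letter (g w) (introT eqP (etrans (size_aut g w) (size_tuple w))).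

(** Row and column [i] of [layer_rep n g] stand for the word [enum_val i] of
    length [n]. Because the action is on the right, this is multiplicative in
    [g]. *)
Definition layer_rep (R : realType) n (g : basilica) :
    'M[R]_#|{: n.-tuple letter}| :=
  \matrix_(i, j) (layer_act (val g) (enum_val i) == enum_val j)%:R.

Lemma layer_repM (R : realType) n g h :
  layer_rep R n (g * h)%g = layer_rep R n g *m layer_rep R n h.
Proof.
apply/matrixP => i j; rewrite !mxE.
rewrite (bigD1 (enum_rank (layer_act (val g) (enum_val i))))//= !mxE.
rewrite enum_rankK eqxx mul1r big1 ?addr0.
  by congr (_ == _)%:R; exact: val_inj.
move=> k kn; rewrite !mxE; case: eqP => [e|]; last by rewrite mul0r.
by move: kn; rewrite e enum_valK eqxx.
Qed.

Definition Q (R : realType) n (p : R * R * R) : R :=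
  let: (lam, mu, nu) := p in
  let pi := @layer_rep R n in
  \det (lam%:M + mu *: (pi gen_a + pi gen_a^-1%g)
               + nu *: (pi gen_b + pi gen_b^-1%g)).

Definition F (R : realType) (p : R * R * R) : R * R * R :=
  let: (lam, mu, nu) := p in
  (lam ^+ 2 + 2 * lam * nu - 2 * mu ^+ 2, lam * nu + 2 * nu ^+ 2, - mu ^+ 2).

Definition K (R : realType) : set (R * R * R) :=
  closure (\bigcup_n (iter n (@F R) @^-1` [set p | Q 1 p = 0])).

Definition cylinder (w : word) : set (nat -> letter) :=
  [set o | mkseq o (size w) = w].

(** Infinite words, with the sigma-algebra generated by the cylinders, which is
    the Borel one *)
Definition boundary := g_sigma_algebraType (range cylinder).
HB.instance Definition _ := Measurable.on boundary.

Definition boundary_act (g : tree_aut) (o : boundary) : boundary :=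
  fun n => nth lx (g (mkseq o n.+1)) n.

Lemma mkseq_boundary_act (g : tree_aut) o n :
  mkseq (boundary_act g o) n = g (mkseq o n).
Proof.
apply: (@eq_from_nth _ lx) => [|i]; first by rewrite size_aut !size_mkseq.
rewrite size_mkseq => ni.
rewrite nth_mkseq// /boundary_act.
have -> : mkseq o i.+1 = take i.+1 (mkseq o n).
  by rewrite -map_take take_iota (minn_idPl ni).
by rewrite aut_take nth_take.
Qed.

Lemma boundary_act_cylinder (g : tree_aut) w :
  boundary_act g @^-1` cylinder w = cylinder (aut_inv g w).
Proof.
apply/seteqP; split=> o; rewrite /cylinder/= mkseq_boundary_act size_autV.
  by move=> <-; rewrite size_aut size_mkseq aut_funK.
by move=> ->; rewrite aut_invK.
Qed.

Lemma measurable_cylinder w : measurable (cylinder w : set boundary).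
Proof. by apply: sub_sigma_algebra; exists w. Qed.

Lemma measurable_boundary_act (g : tree_aut) :
  measurable_fun setT (boundary_act g).
Proof.
apply: (measurability (range cylinder : set (set boundary))) => //.
move=> _ [_ [w _ <-] <-]; rewrite setTI boundary_act_cylinder.
exact: measurable_cylinder.
Qed.

(** The uniform measure is the law of the binary digits of a uniform point of
    [0, 1]; [uniform_cylinder] characterises it. *)

Definition digits (R : realType) (t : measurableTypeR R) : boundary :=
  fun n => odd (Num.truncn (2 ^+ n.+1 * (t : R))).

Section uniform_measure.
Variable R : realType.
Implicit Types t : R.

Lemma measurable_digit n (l : letter) :
  measurable [set t : measurableTypeR R | digits t n = l].
Proof.
pose c : R := 2 ^+ n.+1.
have c0 : 0 < c by rewrite exprn_gt0.
have -> : [set t | digits t n = l] = \bigcup_(k in [set k | odd k = l])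
    [set t | Num.truncn (c * t) = k].
  apply/seteqP; split=> t /=.
    by move=> tl; exists (Num.truncn (c * t)).
  by move=> [k kl tk]; rewrite /digits tk.
apply: bigcup_measurable => k _.
have -> : [set t | Num.truncn (c * t) = k] =
    `]-oo, (k.+1%:R / c)[ `&` (if k is 0%N then setT else `[(k%:R / c), +oo[).
  apply/seteqP; split=> t /=.
    move=> tk; split.
      by rewrite in_itv/= ltr_pdivlMr// mulrC -truncn_le_nat tk.
    case: k tk => // k tk; rewrite /= in_itv/= andbT ler_pdivrMr// mulrC.
    by rewrite -truncn_gt_nat tk.
  rewrite in_itv/= ltr_pdivlMr// mulrC -truncn_le_nat => -[tk kt].
  apply/eqP; rewrite eqn_leq tk/=; case: k kt {tk} => // k.
  by rewrite /= in_itv/= andbT ler_pdivrMr// mulrC -truncn_gt_nat.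
by apply: measurableI => //; case: k.
Qed.

Lemma digits_cylinder (w : word) : @digits R @^-1` cylinder w =
  \bigcap_(i in [set i | (i < size w)%N]) [set t | digits t i = nth lx w i].
Proof.
apply/seteqP; split=> t; rewrite /cylinder/=.
  by move=> tw i /= iw; rewrite -[in RHS]tw nth_mkseq.
move=> tw; apply: (@eq_from_nth _ lx); rewrite size_mkseq// => i iw.
by rewrite nth_mkseq// tw.
Qed.

Lemma measurable_digits :
  measurable_fun setT (@digits R : measurableTypeR R -> boundary).
Proof.
apply: (measurability (range cylinder : set (set boundary))) => //.
move=> _ [_ [w _ <-] <-]; rewrite setTI digits_cylinder.
by apply: bigcap_measurableType => i _; exact: measurable_digit.
Qed.

HB.instance Definition _ :=
  isMeasurableFun.Build _ _ (measurableTypeR R) boundary (@digits R)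
    measurable_digits.

Definition uniform : probability boundary R :=
  distribution (uniform_prob (@ltr01 R))
    (@digits R : {mfun measurableTypeR R >-> boundary}).

Let binval (w : word) := foldl (fun m (l : letter) => m.*2 + l)%N 0 w.

Let binval_rcons w l : binval (rcons w l) = ((binval w).*2 + l)%N.
Proof. by rewrite /binval foldl_rcons. Qed.

Let binval_lt w : (binval w < 2 ^ size w)%N.
Proof.
elim/last_ind: w => // w l IH; rewrite binval_rcons size_rcons expnS mul2n.
by rewrite -addnS (leq_trans (leq_add (leqnn _) (_ : _ <= 2)%N))//;
  [case: l|rewrite addn2 -doubleS leq_double].
Qed.

Let binval_inj u v : size u = size v -> binval u = binval v -> u = v.
Proof.
elim/last_ind: u v => [|u l IH] v; first by move/esym/size0nil.
case/lastP: v => [|v m]; first by rewrite size_rcons.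
rewrite !size_rcons !binval_rcons => -[uv] e.
have lm : l = m.
  by move/(congr1 odd): e; rewrite !oddD !odd_double/= !oddb.
move: e; rewrite lm => /addIn/double_inj/(IH _ uv) ->//.
Qed.

Let truncn_double t : 0 <= t -> (Num.truncn (2 * t))./2 = Num.truncn t.
Proof.
move=> t0; apply/esym/eqP; rewrite truncn_eq//.
have := truncn_itv (mulr_ge0 (ler0n R 2) t0).
rewrite -{1 2}[X in X%:R <= _ < X.+1%:R]odd_double_half.
set k := _./2; set o := odd _ => /andP[kt tk].
rewrite -(ler_pM2l (ltr0n R 2)) -[X in _ && X](ltr_pM2l (ltr0n R 2)).
rewrite -!natrM !mul2n; apply/andP; split.
  by apply: le_trans kt; rewrite ler_nat leq_addl.
apply: (lt_le_trans tk); rewrite ler_nat doubleS.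
by case: o {kt tk}; rewrite /= ?add1n ?add0n.
Qed.

Let truncn_digits t n : 0 <= t < 1 ->
  Num.truncn (2 ^+ n * t) = binval (mkseq (digits t) n).
Proof.
case/andP=> t0 t1; elim: n => [|n IH].
  by apply/eqP; rewrite expr0 mul1r truncn_eq// t0.
have -> : mkseq (digits t) n.+1 = rcons (mkseq (digits t) n) (digits t n).
  by rewrite /mkseq -[in LHS]addn1 iotaD map_cat cats1.
rewrite binval_rcons -IH -[in LHS](odd_double_half (Num.truncn _)) addnC.
congr (_ + _)%N; congr _.*2.
by rewrite exprS -mulrA truncn_double// mulr_ge0// exprn_ge0.
Qed.

Let digits_itv w : @digits R @^-1` cylinder w `&` `[0, 1[%classic =
  (`[(binval w)%:R / 2 ^+ size w, (binval w).+1%:R / 2 ^+ size w[%classic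
    : set R).
Proof.
have c0 : 0 < 2 ^+ size w :> R by rewrite exprn_gt0.
apply/seteqP; split=> t; rewrite /= !in_itv/= ler_pdivrMr// ltr_pdivlMr//.
  case=> tw t01; rewrite ![t * _]mulrC -truncn_eq.
    by rewrite truncn_digits// tw.
  by rewrite mulr_ge0 ?exprn_ge0//; case/andP: t01.
rewrite ![t * _]mulrC => /andP[wt tw].
have ct0 : 0 <= 2 ^+ size w * t by apply: le_trans wt.
have t0 : 0 <= t by rewrite -(pmulr_rge0 _ c0).
have t1 : t < 1.
  rewrite -(ltr_pM2l c0) mulr1 (lt_le_trans tw)// -natrX ler_nat.
  exact: binval_lt.
split; last by rewrite t0.
apply: binval_inj; first by rewrite size_mkseq.
by rewrite -truncn_digits ?t0//; apply/eqP; rewrite truncn_eq// wt.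
Qed.

Lemma uniform_cylinder w : uniform (cylinder w) = (2 ^- size w)%:E.
Proof.
have mw : measurable (@digits R @^-1` cylinder w : set (measurableTypeR R)).
  rewrite -[X in measurable X]setTI; apply: measurable_digits => //.
  exact: measurable_cylinder.
rewrite /uniform/= /distribution/= /pushforward.
rewrite /uniform_prob integral_uniform_pdf.
rewrite (eq_integral (cst 1%E)); last first.
  move=> t; rewrite inE/= in_itv/= => -[_ t01].
  by rewrite /uniform_pdf t01 subr0 invr1.
rewrite integral_cst/=; last exact: measurableI.
rewrite mul1e.
transitivity (lebesgue_measure (@digits R @^-1` cylinder w `&` `[0, 1[%classic)).
  rewrite -(@setUitv1 _ _ (BLeft 0) 1 true) ?bnd_simp// setIUr measureU0//.
  - exact: measurableI.
  - by apply: measurableI => //; exact: measurable_set1.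
  - apply/eqP; rewrite eq_le measure_ge0 andbT -(lebesgue_measure_set1 1).
    apply: le_measure; last exact: subIsetr.
      by apply/mem_set/measurableI => //; exact: measurable_set1.
    by apply: mem_set; exact: measurable_set1.
rewrite digits_itv lebesgue_measure_itv/= lte_fin ltr_pM2r ?invr_gt0 ?exprn_gt0//.
rewrite ltr_nat ltnSn -EFinB -mulrBl -natrB// subSnn mul1r//.
Qed.

End uniform_measure.

Section L2.
Local Open Scope complex_scope.
Context d (T : measurableType d) (R : realType).
Variable mu : {measure set T -> \bar R}.

Definition sqint : {pred T -> R[i]} := [pred f : T -> R[i] |
  (@complex.Re R \o f \in Lfun mu 2%:E) && (@complex.Im R \o f \in Lfun mu 2%:E)].

Let p12 : (1 <= 2%:E :> \bar R)%E. Proof. by rewrite lee_fin ler1n. Qed.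

Lemma sqint_submod_closed : submod_closed sqint.
Proof.
have [L0 LD] := Lfun_submod_closed mu p12.
have LD' (u v w : T -> R) (k l : R) : u \in Lfun mu 2%:E ->
    v \in Lfun mu 2%:E -> w \in Lfun mu 2%:E ->
    (fun t => k * u t + l * v t + w t) \in Lfun mu 2%:E.
  move=> uL vL wL; rewrite (_ : (fun _ => _) = k *: u + (l *: v + w)).
    by apply: (LD _ _ _ uL); exact: (LD _ _ _ vL wL).
  by apply/funext => t; rewrite -addrA.
split; first by apply/andP; split.
move=> k f g /andP[fr fi] /andP[gr gi]; apply/andP; split.
  rewrite (_ : _ \o _ = fun t => complex.Re k * complex.Re (f t) +
      (- complex.Im k) * complex.Im (f t) + complex.Re (g t)).
    exact: LD'.
  apply/funext => t /=; rewrite /GRing.scale/= /GRing.add/=.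
  by case: k (f t) (g t) => [k l] [u v] [u' v'] /=; rewrite mulNr.
rewrite (_ : _ \o _ = fun t => complex.Re k * complex.Im (f t) +
      complex.Im k * complex.Re (f t) + complex.Im (g t)).
  exact: LD'.
apply/funext => t /=; rewrite /GRing.scale/= /GRing.add/=.
by case: k (f t) (g t) => [k l] [u v] [u' v'].
Qed.

Definition L2fun := {f : T -> R[i] | f \in sqint}.
HB.instance Definition _ := [isSub of L2fun for @sval _ _].
HB.instance Definition _ := [Choice of L2fun by <:].
HB.instance Definition _ :=
  GRing.SubChoice_isSubLmodule.Build _ _ sqint L2fun sqint_submod_closed.

Definition ae_null : {pred L2fun} :=
  [pred f : L2fun | `[< {ae mu, forall t, val f t = 0} >]].

Lemma ae_null_submod_closed : submod_closed ae_null.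
Proof.
split; first by apply/asboolP; exact: aeW.
move=> k f g /asboolP f0 /asboolP g0; apply/asboolP.
apply: filterS2 f0 g0 => t f0 g0.
by rewrite linearP/= /GRing.add/= /GRing.scale/= f0 g0 scaler0 addr0.
Qed.

HB.instance Definition _ :=
  GRing.isSubmodClosed.Build _ _ ae_null ae_null_submod_closed.

(** Square-integrable functions modulo equality almost everywhere *)
Definition L2 := Quotient.quot ae_null.
HB.instance Definition _ := GRing.Zmodule.on L2.
HB.instance Definition _ := EqQuotient.on L2.

Definition L2class (f : L2fun) : L2 := \pi_L2%qT f.

Lemma L2classP (f g : L2fun) :
  L2class f = L2class g <-> {ae mu, forall t, val f t = val g t}.
Proof.
split=> [/eqP|fg].
  rewrite -Quotient.idealrBE => /asboolP; apply: filterS => t /eqP.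
  by rewrite raddfB/= subr_eq0 => /eqP.
apply/eqP; rewrite -Quotient.idealrBE; apply/asboolP.
by apply: filterS fg => t; rewrite raddfB/= => /eqP; rewrite -subr_eq0 => /eqP.
Qed.

Lemma L2classK (q : L2) : L2class (repr q) = q.
Proof. exact: reprK. Qed.

Lemma L2classB : {morph L2class : f g / f - g}.
Proof. exact: raddfB. Qed.

Lemma L2classD : {morph L2class : f g / f + g}.
Proof. exact: raddfD. Qed.

Definition L2scale (k : R[i]) (q : L2) : L2 := L2class (k *: repr q).

Lemma L2classZ k f : L2class (k *: f) = L2scale k (L2class f).
Proof.
apply/L2classP.
have /L2classP := L2classK (L2class f).
apply: filterS => t ft.
by rewrite !linearZ/= /GRing.scale/= ft.
Qed.

Let L2scaleA a b q : L2scale a (L2scale b q) = L2scale (a * b) q.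
Proof. by rewrite -(L2classK q) -!L2classZ scalerA. Qed.

Let L2scale1 : left_id 1 L2scale.
Proof. by move=> q; rewrite -(L2classK q) -!L2classZ scale1r. Qed.

Let L2scaleDr : right_distributive L2scale +%R.
Proof.
move=> a q r; rewrite -(L2classK q) -(L2classK r).
by rewrite -L2classD -!L2classZ -L2classD scalerDr.
Qed.

Let L2scaleDl q : {morph L2scale^~ q : a b / a + b}.
Proof.
by move=> a b /=; rewrite -(L2classK q) -!L2classZ -L2classD scalerDl.
Qed.

HB.instance Definition _ := GRing.Zmodule_isLmodule.Build R[i] L2
  L2scaleA L2scale1 L2scaleDr L2scaleDl.

Lemma measurable_L2Re (f : L2fun) :
  measurable_fun setT (@complex.Re R \o val f).
Proof.
by have /andP[/sub_Lfun_mfun + _] := valP f; rewrite inE.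
Qed.

Lemma measurable_L2Im (f : L2fun) :
  measurable_fun setT (@complex.Im R \o val f).
Proof.
by have /andP[_ /sub_Lfun_mfun] := valP f; rewrite inE.
Qed.

Definition L2abs (f : L2fun) : T -> R := fun t => Normc.normc (val f t).

Lemma L2abs_ge0 f t : 0 <= L2abs f t.
Proof. by rewrite /L2abs; case: (val f t) => u v; exact: sqrtr_ge0. Qed.

Lemma measurable_L2abs f : measurable_fun setT (L2abs f).
Proof.
rewrite (_ : L2abs f = Num.sqrt \o (fun t =>
    complex.Re (val f t) ^+ 2 + complex.Im (val f t) ^+ 2)); last first.
  by apply/funext => t; rewrite /L2abs/=; case: (val f t).
apply: measurableT_comp.
  by apply: continuous_measurable_fun; exact: sqrt_continuous.
by apply: measurable_funD; apply: measurable_funX;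
  [exact: measurable_L2Re|exact: measurable_L2Im].
Qed.

Let measurable_pow2 (u : T -> R) : measurable_fun setT u ->
  measurable_fun setT (fun t => `|(EFin \o u) t| `^ 2)%E.
Proof.
move=> mu'; rewrite (_ : (fun _ => _) = EFin \o (fun t => `|u t| `^ 2))//.
apply/measurable_EFinP; apply: (measurableT_comp (measurable_powR 2)).
exact: measurableT_comp.
Qed.

Let le_Lnorm2 (u v : T -> R) : measurable_fun setT u -> measurable_fun setT v ->
  (forall t, 0 <= u t <= v t) ->
  ('N[mu]_2%:E[EFin \o u] <= 'N[mu]_2%:E[EFin \o v])%E.
Proof.
move=> mu' mv uv; rewrite unlock gt0_ler_poweR//.
- by rewrite in_itv/= leey integral_ge0// => t _; exact: poweR_ge0.
- by rewrite in_itv/= leey integral_ge0// => t _; exact: poweR_ge0.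
apply: ge0_le_integral => //.
- by move=> t _; exact: poweR_ge0.
- exact: measurable_pow2.
- exact: measurable_pow2.
- move=> t _; have /andP[u0 uvt] := uv t.
  rewrite /= lee_fin ge0_ler_powR//= ?nnegrE//.
  by rewrite !ger0_norm// (le_trans u0).
Qed.

Lemma L2abs_Lfun f : L2abs f \in Lfun mu 2%:E.
Proof.
apply/andP; split; rewrite inE/=; first exact: measurable_L2abs.
have /andP[fr fi] := valP f.
have mr := measurable_L2Re f; have mi := measurable_L2Im f.
pose u := Num.norm \o (@complex.Re R \o val f).
pose v := Num.norm \o (@complex.Im R \o val f).
have uv : ('N[mu]_2%:E[EFin \o L2abs f] <= 'N[mu]_2%:E[EFin \o (u \+ v)%R])%E.
  apply: le_Lnorm2.
  - exact: measurable_L2abs.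
  - by apply: measurable_funD; exact: measurableT_comp.
  move=> t; rewrite L2abs_ge0/= /u /v /L2abs/=; case: (val f t) => {}u {}v /=.
  rewrite -(@ler_pXn2r _ 2)// ?nnegrE ?sqrtr_ge0 ?addr_ge0//.
  rewrite sqr_sqrtr ?addr_ge0 ?sqr_ge0// sqrrD !real_normK ?num_real//.
  by rewrite lerD2r lerDl mulrn_wge0// mulr_ge0.
apply: (le_lt_trans uv); apply: (le_lt_trans (eminkowski _ _ _ p12)).
- exact: measurableT_comp.
- exact: measurableT_comp.
have abs_fin (w : T -> R) : w \in Lfun mu 2%:E ->
    ('N[mu]_2%:E[EFin \o (Num.norm \o w)] < +oo)%E.
  move=> /sub_Lfun_finLfun; rewrite inE/= /finite_norm.
  by rewrite -Lnorm_abse.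
by rewrite lte_add_pinfty// abs_fin.
Qed.

Definition L2fun_norm (f : L2fun) : R := fine 'N[mu]_2%:E[EFin \o L2abs f]%E.

Let L2fun_normE f : (L2fun_norm f)%:E = 'N[mu]_2%:E[EFin \o L2abs f]%E.
Proof. exact: (finite_norm_fine (Lfun_Sub p12 (L2abs_Lfun f))). Qed.

Definition L2norm (q : L2) : R := L2fun_norm (repr q).

Lemma L2norm_class f : L2norm (L2class f) = L2fun_norm f.
Proof.
rewrite /L2norm /L2fun_norm unlock; congr (fine (_ `^ _)%E).
have /L2classP fE := L2classK (L2class f).
apply: ae_eq_integral => //.
- exact/measurable_pow2/measurable_L2abs.
- exact/measurable_pow2/measurable_L2abs.
- by apply: filterS fE => t ft _; rewrite /L2abs/= ft.
Qed.

Let L2normD q r : L2norm (q + r) <= L2norm q + L2norm r.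
Proof.
rewrite -(L2classK q) -(L2classK r) -L2classD !L2norm_class.
set f := repr q; set g := repr r.
rewrite -lee_fin EFinD !L2fun_normE.
have fg : ('N[mu]_2%:E[EFin \o L2abs (f + g)%R] <=
    'N[mu]_2%:E[EFin \o (L2abs f \+ L2abs g)%R])%E.
  apply: le_Lnorm2; first exact: measurable_L2abs.
    by apply: measurable_funD; exact: measurable_L2abs.
  move=> t; rewrite L2abs_ge0/= /L2abs.
  have -> : val (f + g) t = val f t + val g t by rewrite raddfD.
  by have := ler_normD (val f t) (val g t); rewrite -lecR rmorphD.
by apply: (le_trans fg); apply: eminkowski => //; exact: measurable_L2abs.
Qed.

Let L2normZ (k : R[i]) q : L2norm (k *: q) = Normc.normc k * L2norm q.
Proof.
rewrite -(L2classK q) [_ *: _](_ : _ = L2class (k *: repr q)); last first.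
  by rewrite L2classZ.
rewrite !L2norm_class; apply: EFin_inj.
have k0 : 0 <= Normc.normc k by case: k => u v; exact: sqrtr_ge0.
rewrite EFinM !L2fun_normE.
have := LnormZ (Lfun_Sub p12 (L2abs_Lfun (repr q))) (Normc.normc k).
rewrite ger0_norm// => <-; congr ('N[mu]_2%:E[_])%E.
apply/funext => t /=; congr EFin.
by rewrite /L2abs linearZ/= Normc.normcM.
Qed.

Let L2norm_eq0 q : L2norm q = 0 -> q = 0.
Proof.
rewrite -(L2classK q) L2norm_class => f0.
have /= := fine_Lnormr_eq0 (f := Lfun_Sub p12 (L2abs_Lfun (repr q))) f0.
rewrite -[X in _ -> _ = X](L2classK 0) => H; apply/L2classP.
have /L2classP := L2classK (L2class 0).
have -> : L2class 0 = 0 by exact: raddf0.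
apply: filterS2 H => t /= f0t ->.
by apply: ComplexField.Normc.eq0_normc; exact: f0t.
Qed.

Let L2cnormD q r : (L2norm (q + r))%:C <= (L2norm q)%:C + (L2norm r)%:C.
Proof. by rewrite -rmorphD lecR L2normD. Qed.

Let L2cnormZ (k : R[i]) q : (L2norm (k *: q))%:C = `|k| * (L2norm q)%:C.
Proof. by rewrite L2normZ rmorphM. Qed.

Let L2cnorm_eq0 q : (L2norm q)%:C = 0 -> q = 0.
Proof. by move=> /complexI/L2norm_eq0. Qed.

(** The norm of a normed [R[i]]-module takes its values in [R[i]]. *)
HB.instance Definition _ :=
  @Lmodule_isNormed.Build R[i] L2 (fun q => (L2norm q)%:C)
    L2cnormD L2cnormZ L2cnorm_eq0.

Lemma L2_normE q : `|q| = (L2norm q)%:C.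
Proof. by []. Qed.

End L2.

Section koopman.
Variable R : realType.
Notation uniform := (uniform R).

Let cylinderI : setI_closed (range cylinder `|` [set set0]).
Proof.
have cylI u v : (size u <= size v)%N ->
    (range cylinder `|` [set set0]) (cylinder u `&` cylinder v).
  move=> uv; have [vu|vu] := eqVneq (take (size u) v) u.
    left; exists v => //; apply/seteqP; split=> o; last by case.
    rewrite /cylinder/= => ov; split=> //.
    by rewrite -[RHS]vu -ov -map_take take_iota (minn_idPl uv).
  right; rewrite /cylinder; apply/seteqP; split=> // o [/= ou ov].
  case/eqP: vu; rewrite -[RHS]ou -ov -map_take take_iota.
  by rewrite (minn_idPl uv).
move=> _ _ [[u _ <-]|->] [[v _ <-]|->]; rewrite ?setI0 ?set0I; try by right.
have [/cylI//|/ltnW/cylI] := leqP (size u) (size v).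
by rewrite setIC.
Qed.

Let cylinder_sigma : @measurable _ boundary =
  <<s range cylinder `|` [set set0] >>.
Proof.
apply/seteqP; split.
  by apply: sub_sigma_algebra2; exact: subsetUl.
apply: smallest_sub; first exact: sigma_algebra_measurable.
by move=> _ [[w _ <-]|->]; [exact: measurable_cylinder|exact: measurable0].
Qed.

HB.instance Definition _ (g : tree_aut) :=
  isMeasurableFun.Build _ _ boundary boundary (boundary_act g)
    (measurable_boundary_act g).

Lemma uniform_boundary_act (g : tree_aut) (A : set boundary) : measurable A ->
  uniform (boundary_act g @^-1` A) = uniform A.
Proof.
move=> mA.
apply: (measure_unique (range cylinder `|` [set set0] : set (set boundary))
  (fun=> cylinder [::]) cylinder_sigma cylinderI _ _
  (distribution uniform (boundary_act g : {mfun boundary >-> boundary}))) => //.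
- by move=> _; left; exists [::].
- by apply/seteqP; split=> // o _; exists 0%N.
- move=> _ [[w _ <-]|->]; last by rewrite !measure0.
  rewrite [LHS](_ : _ = uniform (cylinder (aut_inv g w))); last first.
    by rewrite -boundary_act_cylinder.
  apply: etrans (uniform_cylinder R _) _; rewrite size_autV.
  exact: esym (uniform_cylinder R _).
- move=> _; apply: (@le_lt_trans _ _ 1%E); last exact: ltry.
  by apply: probability_le1; exact: measurable_cylinder.
Qed.

Lemma Lnorm_boundary_act (g : tree_aut) (u : boundary -> R) :
  measurable_fun setT u ->
  'N[uniform]_2%:E[EFin \o (u \o boundary_act g)]%E =
  'N[uniform]_2%:E[EFin \o u]%E.
Proof.
move=> mu; rewrite unlock; congr (_ `^ _)%E.
pose h t := (`|(EFin \o u) t| `^ 2)%E.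
have mh : measurable_fun setT h.
  rewrite (_ : h = EFin \o (fun t => `|u t| `^ 2))//.
  apply/measurable_EFinP; apply: (measurableT_comp (measurable_powR 2)).
  exact: measurableT_comp.
transitivity (\int[pushforward uniform (boundary_act g)]_t h t)%E.
  rewrite (ge0_integral_pushforward (measurable_boundary_act g))//.
  by move=> t _; exact: poweR_ge0.
apply: (@eq_measure_integral _ _ _ setT uniform
  (distribution uniform (boundary_act g : {mfun boundary >-> boundary}))).
by move=> A mA _; exact: uniform_boundary_act.
Qed.

Lemma sqint_boundary_act (g : tree_aut) (f : L2fun uniform) :
  val f \o boundary_act g \in sqint uniform.
Proof.
have H (u : boundary -> R) : u \in Lfun uniform 2%:E ->
    u \o boundary_act g \in Lfun uniform 2%:E.
  move=> /andP[]; rewrite !inE/= => mu fu; apply/andP; split; rewrite inE/=.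
    by apply: measurableT_comp => //; exact: measurable_boundary_act.
  by rewrite /finite_norm Lnorm_boundary_act.
have /andP[fr fi] := valP f.
by apply/andP; split; [exact: (H _ fr)|exact: (H _ fi)].
Qed.

Definition boundary_pull (g : tree_aut) (f : L2fun uniform) : L2fun uniform :=
  exist _ (val f \o boundary_act g) (sqint_boundary_act g f).

(** [(pi(g) f)(o) = f(o^g)] *)
Definition boundary_rep (g : basilica) (q : L2 uniform) : L2 uniform :=
  L2class (boundary_pull (val g) (repr q)).

Lemma boundary_rep_class g (f : L2fun uniform) :
  boundary_rep g (L2class f) = L2class (boundary_pull (val g) f).
Proof.
apply/L2classP.
have /L2classP[A [mA A0 nA]] := L2classK (L2class f).
exists (boundary_act (val g) @^-1` A); split.
- by rewrite -[X in measurable X]setTI; exact: measurable_boundary_act.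
- by rewrite -A0; exact: uniform_boundary_act.
- by move=> t /= ft; apply: nA => /= e; apply: ft; rewrite /= e.
Qed.

Lemma boundary_rep_linear g : linear (boundary_rep g).
Proof.
move=> k q r; rewrite -(L2classK q) -(L2classK r).
rewrite -[k *: L2class _]L2classZ -L2classD !boundary_rep_class.
rewrite -[k *: L2class _]L2classZ -L2classD.
by congr L2class; apply/val_inj.
Qed.

HB.instance Definition _ g := GRing.isLinear.Build R[i] (L2 uniform)
  (L2 uniform) *:%R (boundary_rep g) (boundary_rep_linear g).

Lemma norm_boundary_rep g q : `|boundary_rep g q| = `|q|.
Proof.
rewrite -(L2classK q) boundary_rep_class !L2_normE !L2norm_class.
by congr (fine _)%:C%C; exact/Lnorm_boundary_act/measurable_L2abs.
Qed.

Lemma boundary_rep1 q : boundary_rep 1%g q = q.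
Proof.
rewrite -[RHS]L2classK; congr L2class; apply/val_inj/funext => o /=.
by congr (sval _ _); apply/funext => n; rewrite /boundary_act/= nth_mkseq.
Qed.

Lemma boundary_repM g h q :
  boundary_rep (g * h)%g q = boundary_rep g (boundary_rep h q).
Proof.
rewrite -(L2classK q) !boundary_rep_class; congr L2class.
apply/val_inj/funext => o /=; congr (sval _ _); apply/funext => n.
by rewrite {2}/boundary_act mkseq_boundary_act.
Qed.

End koopman.

(** The spectrum of [A] in B(V). Continuity of a linear map between normed
    modules is boundedness. *)
Definition spectrum (C : numFieldType) (V : normedModType C) (A : V -> V) :
    set C :=
  [set z | ~ exists B : {linear V -> V}, [/\ continuous B,
     forall v, B (A v - z *: v) = v & forall v, A (B v) - z *: B v = v]].

(** The spectrum of a representation with respect to a finite generating set,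
    listed without repetition by [S] *)
Definition rep_spectrum (C : numFieldType) (V : normedModType C) (G : Type)
    (rho : G -> V -> V) (S : seq G) : set C :=
  [set (size S)%:R^-1 * z | z in spectrum (fun v => \sum_(s <- S) rho s v)].

(* Main.v *)
From HB Require Import structures.
Require Import Defs.
From mathcomp Require Import all_boot all_order all_algebra.
From mathcomp Require Import perm spectral sesquilinear.
From mathcomp Require Import all_classical all_reals all_analysis.
From mathcomp Require Import measurable_realfun complex.
From mathcomp Require Import ring lra.

Set Implicit Arguments.
Unset Strict Implicit.
Unset Printing Implicit Defensive.

Import Order.TTheory GRing.Theory Num.Theory.
Import numFieldNormedType.Exports.
Import HBSimple HBNNSimple.

Local Open Scope classical_set_scope.
Local Open Scope complex_scope.
Local Open Scope ring_scope.

(** Determinants. Splitting a word after its first letter turns the matrices of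
    [a] and [b] at level [n + 1] into 2 x 2 block matrices whose blocks are
    matrices at level [n]. In the matrix that defines [Q], the lower right
    block is the scalar [lam + 2 nu], so the determinant is that of the Schur
    complement [det_block_scalar]; because [b] is invertible this is again a
    matrix of the same shape, with parameters [F (lam, mu, nu)]. Hence [Q_rec],
    valid from level 0 on, and everything about [Q] follows from [Q0E].

    Spectrum. Let [A] be the sum of the four generators acting on L2. Functions
    that depend on the first [n] letters only form an [A]-invariant space, on
    which [A] is the real symmetric matrix [gens_mx n], and [Q n] at
    [mu = nu = -1/4] vanishes exactly at its eigenvalues divided by 4. By the
    recursion, the zeros of [Q n] for varying [n] are the points of the union
    whose closure is [K].

    If [z / 4] is not in the slice of [K], it stays at distance at least
    [e > 0] from all these eigenvalues, uniformly in [n]. By the spectral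
    theorem [hermitian_bounded_below], [A - z] is then invertible on each level
    and expands norms by at least [4 e] there. The levels are dense
    ([step_dense]) and L2 is complete ([L2_complete]), so the lower bound extends
    to L2 and [A - z] is onto, with a bounded inverse ([resolvent_exists]).

    Conversely the closure defining [K] is taken in space and not in the line
    [mu = nu = -1/4], so a point of the slice is only a limit of parameters
    [(l, m, v)], possibly off the line, at which some [Q n] vanishes. Such a
    zero yields a function in the kernel of [l + m (a + a^-1) + v (b + b^-1)].
    On this function [A - 4 lam] is small, in proportion to the distance from
    [(l, m, v)] to [(lam, -1/4, -1/4)] ([L2norm_perturb]), since the generators
    act by isometries. So [A - 4 lam] has no bounded inverse ([K_sub_spectrum]). *)

Notation layer_size n := #|{: n.-tuple letter}|.
Notation layer n := 'I_(layer_size n).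

(** * The determinant recursion *)

Lemma det_mxsub_bij (S : comNzRingType) m n (f : 'I_m -> 'I_n) (A : 'M[S]_n) :
  bijective f -> \det (mxsub f f A) = \det A.
Proof.
move=> bf; have mn : m = n by have /= := bij_eq_card bf; rewrite !card_ord.
case: _ / mn in f bf A *.
pose s := perm (bij_inj bf).
have -> : mxsub f f A = row_perm s (col_perm s A).
  by apply/matrixP => i j; rewrite !mxE !permE.
rewrite row_permE col_permE !det_mulmx !det_perm.
rewrite mulrCA -signr_addb odd_permV addbb mulr1//.
Qed.

(** Multiplying the block matrix by a block triangular one of determinant
    [d ^+ n] proves this up to the factor [d ^+ n] on both sides. To cancel the
    factor even for [d = 0], [d] is first replaced by an indeterminate. *)
Lemma det_block_scalar (S : idomainType) n (A B C : 'M[S]_n) (d : S) :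
  \det (block_mx A B C d%:M) = \det (d *: A - B *m C).
Proof.
pose P := @map_mx _ _ (@polyC S) n n.
have key : \det (block_mx (P A) (P B) (P C) 'X%:M) =
    \det ('X *: P A - P B *m P C).
  apply: (@mulIf _ ('X ^+ n)); first by rewrite expf_neq0 ?polyX_eq0.
  have e : block_mx (P A) (P B) (P C) 'X%:M *m
      block_mx ('X%:M) 0 (- P C) 1%:M =
      block_mx ('X *: P A - P B *m P C) (P B) 0 'X%:M.
    rewrite mulmx_block !mulmx0 !mulmx1 !add0r mulmxN mul_mx_scalar.
    by rewrite mul_mx_scalar mulmxN mul_scalar_mx subrr.
  have := congr1 determinant e; rewrite det_mulmx det_lblock det_ublock.
  by rewrite det1 mulr1 !det_scalar.
have := congr1 (horner_eval d) key; rewrite -!det_map_mx map_block_mx.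
have PK (D : 'M[S]_n) : map_mx (horner_eval d) (P D) = D.
  by apply/matrixP => i j; rewrite !mxE /horner_eval hornerC.
have XK : map_mx (horner_eval d) ('X%:M : 'M[{poly S}]_n) = d%:M.
  by apply/matrixP => i j; rewrite !mxE /horner_eval hornerMn hornerX.
rewrite map_mxB map_mxM map_mxZ !PK XK => ->.
by rewrite /= /horner_eval hornerX.
Qed.

Section recursion.
Variable R : realType.

Definition layer_cons n (k : 'I_(layer_size n + layer_size n)) : layer n.+1 :=
  match fintype.split k with
  | inl i => enum_rank (cons_tuple lx (enum_val i))
  | inr i => enum_rank (cons_tuple ly (enum_val i))
  end.

(** The matrix at level [n + 1], its rows and columns reordered so that the words
    starting with [x] come before those starting with [y]. *)
Definition split_layer n (A : 'M[R]_(layer_size n.+1)) :=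
  mxsub (@layer_cons n) (@layer_cons n) A.

Lemma layer_cons_bij n : bijective (@layer_cons n).
Proof.
apply: inj_card_bij; last first.
  by rewrite !card_ord !card_tuple card_bool expnS mul2n addnn.
move=> i j; rewrite /layer_cons -{2}(splitK i) -{2}(splitK j).
case: (fintype.split i) (fintype.split j) => {}i [] {}j;
  by move=> /enum_rank_inj/(congr1 val)//= [] /val_inj/enum_val_inj ->.
Qed.

Definition layer_word n (i : layer n) : word :=
  tval (enum_val i).

Lemma layer_repE n (g : basilica) i j :
  layer_rep R n g i j = (val g (layer_word i) == layer_word j)%:R.
Proof. by rewrite mxE. Qed.

Lemma mxsub_layer_cons n (g : basilica) (A B C D : 'M[R]_(layer_size n)) :
  let entry x y (i j : layer n) : R :=
    (val g (x :: layer_word i) == y :: layer_word j)%:R in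
  entry lx lx =2 A -> entry lx ly =2 B ->
  entry ly lx =2 C -> entry ly ly =2 D ->
  split_layer (layer_rep R n.+1 g) = block_mx A B C D.
Proof.
move=> entry a b c d; apply/matrixP => i j; rewrite mxE layer_repE mxE.
rewrite /layer_cons; case: (fintype.split i) => i'; rewrite mxE;
  case: (fintype.split j) => j'; rewrite /layer_word !enum_rankK/=;
  by [exact: a|exact: b|exact: c|exact: d].
Qed.

Let consE (x y : letter) (u v : word) :
  (x :: u == y :: v) = (x == y) && (u == v).
Proof. by []. Qed.

Let enumE n (i j : layer n) :
  (layer_word i == layer_word j) = (i == j).
Proof.
by apply/eqP/eqP => [/val_inj/enum_val_inj|->].
Qed.

Lemma layer_rep1 n : layer_rep R n 1%g = 1%:M.
Proof. by apply/matrixP => i j; rewrite layer_repE mxE enumE. Qed.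

Lemma layer_rep_cons_a n :
  split_layer (layer_rep R n.+1 gen_a) =
    block_mx 0 (layer_rep R n gen_b) 1%:M 0.
Proof.
by apply: mxsub_layer_cons => i j; rewrite ?layer_repE ?mxE//= ?consE/= ?enumE.
Qed.

Lemma layer_rep_cons_aV n :
  split_layer (layer_rep R n.+1 gen_a^-1%g) =
    block_mx 0 1%:M (layer_rep R n gen_b^-1%g) 0.
Proof.
by apply: mxsub_layer_cons => i j; rewrite ?layer_repE ?mxE//= ?consE/= ?enumE.
Qed.

Lemma layer_rep_cons_b n :
  split_layer (layer_rep R n.+1 gen_b) =
    block_mx (layer_rep R n gen_a) 0 0 1%:M.
Proof.
by apply: mxsub_layer_cons => i j; rewrite ?layer_repE ?mxE//= ?consE/= ?enumE.
Qed.

Lemma layer_rep_cons_bV n :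
  split_layer (layer_rep R n.+1 gen_b^-1%g) =
    block_mx (layer_rep R n gen_a^-1%g) 0 0 1%:M.
Proof.
by apply: mxsub_layer_cons => i j; rewrite ?layer_repE ?mxE//= ?consE/= ?enumE.
Qed.

(** The off-diagonal blocks are [mu (1 + b)] and [mu (1 + b^-1)]; their product is
    [mu^2 (2 + b + b^-1)], which explains the terms in [mu ^+ 2] of [F]. *)
Lemma Q_rec n (p : R * R * R) : Q n.+1 p = Q n (F p).
Proof.
case: p => [[l m] v]; rewrite /Q/=.
rewrite -(det_mxsub_bij _ (layer_cons_bij n)) -/(split_layer _).
have subD (A B : 'M[R]_(layer_size n.+1)) :
    split_layer (A + B) = split_layer A + split_layer B.
  by apply/matrixP => i j; rewrite !mxE.
have subZ k (A : 'M[R]_(layer_size n.+1)) :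
    split_layer (k *: A) = k *: split_layer A.
  by apply/matrixP => i j; rewrite !mxE.
have sub1 : split_layer (n := n) l%:M = block_mx l%:M 0 0 l%:M.
  rewrite -scalar_mx_block; apply/matrixP => i j; rewrite !mxE.
  by rewrite (inj_eq (bij_inj (layer_cons_bij n))).
rewrite !(subD, subZ) sub1 layer_rep_cons_a layer_rep_cons_b.
rewrite layer_rep_cons_aV layer_rep_cons_bV.
rewrite !(add_block_mx, scale_block_mx) !(addr0, add0r, scaler0).
have -> : l%:M + v *: (1%:M + 1%:M) = (l + 2 * v)%:M
    :> 'M[R]_(layer_size n).
  by apply/matrixP => i j; rewrite !mxE; case: (i == j); rewrite /=; ring.
rewrite det_block_scalar; congr (\det _).
have bbV : layer_rep R n gen_b *m layer_rep R n gen_b^-1%g = 1%:M.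
  by rewrite -layer_repM mulgV layer_rep1.
rewrite -scalemxAl -scalemxAr mulmxDl !mulmxDr bbV !mul1mx !mulmx1.
by apply/matrixP => i j; rewrite !mxE; case: (i == j); rewrite /=; ring.
Qed.

Lemma Q0E (l m v : R) : Q 0 (l, m, v) = l + 2 * m + 2 * v.
Proof.
have [g gK Kg] : bijective (fun i : 'I_1 => enum_rank [tuple] : layer 0).
  apply: inj_card_bij; first by move=> i j _; rewrite !ord1.
  by rewrite !card_ord card_tuple expn0.
rewrite /Q -(det_mxsub_bij _ (Bijective gK Kg)) det_mx11.
rewrite !mxE !eqxx.
have e (u w : 0.-tuple letter) : (u == w) = true.
  by rewrite (tuple0 u) (tuple0 w).
by rewrite !e/= mulr1n; ring.
Qed.

Lemma Q1E (l m v : R) : Q 1 (l, m, v) = Q 0 (l, m, v) * (l - 2 * m + 2 * v).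
Proof. by rewrite Q_rec /F !Q0E; ring. Qed.

End recursion.

(** * The norm of square-integrable functions *)

Section L2_space.
Context d (T : measurableType d) (R : realType).
Variable mu : {measure set T -> \bar R}.
Implicit Types (f g : L2fun mu) (p q r : L2 mu).

Lemma normc_sqr (x : R[i]) :
  Normc.normc x ^+ 2 = complex.Re x ^+ 2 + complex.Im x ^+ 2.
Proof. by case: x => u v /=; rewrite sqr_sqrtr// addr_ge0 ?sqr_ge0. Qed.

Lemma L2norm_sqr f :
  ((L2norm (L2class f)) ^+ 2)%:E = (\int[mu]_t (L2abs f t ^+ 2)%:E)%E.
Proof.
rewrite L2norm_class EFin_expe /L2fun_norm.
have p12 : (1 <= 2%:E :> \bar R)%E by rewrite lee_fin ler1n.
have -> : (fine 'N[mu]_2%:E[EFin \o L2abs f])%:E =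
    'N[mu]_2%:E[EFin \o L2abs f]%E.
  exact: (finite_norm_fine (Lfun_Sub p12 (L2abs_Lfun f))).
transitivity ('N[mu]_2%:E[EFin \o L2abs f] `^ 2)%E.
  have := Lnorm_ge0 mu 2%:E (EFin \o L2abs f).
  case: ('N[mu]_2%:E[EFin \o L2abs f])%E => [x|_|]//=.
    by rewrite lee_fin => x0; rewrite powR_mulrn.
  by rewrite gt_eqF.
rewrite poweR_Lnorm//; apply: eq_integral => t _ /=.
by rewrite powR_mulrn// ger0_norm// L2abs_ge0.
Qed.

Lemma sqintP (u : T -> R[i]) :
  measurable_fun setT (@complex.Re R \o u) ->
  measurable_fun setT (@complex.Im R \o u) ->
  (\int[mu]_t (Normc.normc (u t) ^+ 2)%:E < +oo)%E ->
  u \in sqint mu.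
Proof.
move=> mr mi fu.
have mn : measurable_fun setT
    (EFin \o (fun t => (Normc.normc (u t)) ^+ 2) : T -> \bar R).
  apply/measurable_EFinP.
  rewrite (_ : (fun _ => _) =
      (fun t : T => complex.Re (u t) ^+ 2 + complex.Im (u t) ^+ 2)).
    by apply: measurable_funD; apply: measurable_funX.
  by apply/funext => t; rewrite normc_sqr.
have H (v : T -> R) : measurable_fun setT v ->
    (forall t, v t ^+ 2 <= Normc.normc (u t) ^+ 2) -> v \in Lfun mu 2%:E.
  move=> mv vu; apply/andP; split; rewrite inE//=.
  rewrite /finite_norm unlock poweR_lty//.
  apply: le_lt_trans fu; apply: ge0_le_integral => //.
  - by move=> t _; exact: poweR_ge0.
  - rewrite (_ : (fun _ => _) = EFin \o (fun t => `|v t| `^ 2))//.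
    apply/measurable_EFinP; apply: (measurableT_comp (measurable_powR 2)).
    exact: measurableT_comp.
  - by move=> t _ /=; rewrite lee_fin powR_mulrn// real_normK ?num_real.
apply/andP; split; apply: H => // t; rewrite normc_sqr.
  by rewrite lerDl sqr_ge0.
by rewrite lerDr sqr_ge0.
Qed.

Lemma L2norm_ge0 q : 0 <= L2norm q.
Proof. by have := normr_ge0 q; rewrite L2_normE lecR. Qed.

Lemma L2norm_triangle q r : L2norm (q + r) <= L2norm q + L2norm r.
Proof. by have := ler_normD q r; rewrite !L2_normE -rmorphD lecR. Qed.

Lemma L2normN q : L2norm (- q) = L2norm q.
Proof. by have := normrN q; rewrite !L2_normE => /complexI. Qed.

Lemma L2norm_distC q r : L2norm (q - r) = L2norm (r - q).
Proof. by rewrite -L2normN opprB. Qed.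

Lemma L2norm_dist q r p : L2norm (q - r) <= L2norm (q - p) + L2norm (p - r).
Proof. by rewrite (le_trans _ (L2norm_triangle _ _))// addrA subrK. Qed.

Lemma L2norm_scale (k : R[i]) q : L2norm (k *: q) = Normc.normc k * L2norm q.
Proof.
have := normrZ k q; rewrite !L2_normE => e; apply: complexI.
by rewrite e rmorphM.
Qed.

Lemma L2norm_eq0 q : L2norm q = 0 -> q = 0.
Proof. by move=> q0; apply/normr0_eq0; rewrite L2_normE q0. Qed.

Lemma L2norm0 : L2norm (0 : L2 mu) = 0.
Proof. by apply: complexI; rewrite -L2_normE normr0. Qed.

Lemma L2norm_small_eq q r :
  (forall e : R, 0 < e -> L2norm (q - r) <= e) -> q = r.
Proof.
move=> qr; apply/eqP; rewrite -subr_eq0; apply/eqP/L2norm_eq0/eqP.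
rewrite eq_le L2norm_ge0 andbT; apply/ler_addgt0Pl => e e0.
by rewrite addr0 qr.
Qed.

Lemma L2class_surj q : exists f, q = L2class f.
Proof. by exists (repr q); rewrite L2classK. Qed.

End L2_space.

(** * Completeness of L2 *)

(** The explicit rate lets one bound the distance to a pointwise limit without
    passing to the limit under an integral. *)
Lemma cvgn_geometric (R : realType) (x : nat -> R) (c : R) :
  (forall k, `|x k.+1 - x k| <= c * 2^-1 ^+ k) ->
  exists l, x @ \oo --> l /\ forall n, `|l - x n| <= 2 * c * 2^-1 ^+ n.
Proof.
move=> xc; have h0 k : 0 <= c * 2^-1 ^+ k.
  exact: le_trans (normr_ge0 _) (xc k).
have c0 : 0 <= c by have := h0 0%N; rewrite expr0 mulr1.
have xcv : cvgn x.
  have -> : x = (fun n => x 0%N + series (telescope x) n).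
    by apply/funext => n; rewrite -eq_sum_telescope.
  apply: is_cvgD; first exact: is_cvg_cst.
  apply: normed_cvg; apply: (@series_le_cvg _ _ (geometric c 2^-1)) => //.
    by move=> n; exact: normr_ge0.
  apply: is_cvg_geometric_series; rewrite ger0_norm ?invr_ge0// invf_lt1//.
  by rewrite ltr1n.
have dist n m : `|x (n + m)%N - x n| <= 2 * c * 2^-1 ^+ n * (1 - 2^-1 ^+ m).
  elim: m => [|m IH]; first by rewrite addn0 subrr normr0 expr0 subrr mulr0.
  rewrite addnS -(subrK (x (n + m)%N) (x (n + m).+1)) -addrA.
  apply: le_trans (ler_normD _ _) _; apply: le_trans (lerD (xc _) IH) _.
  by rewrite exprD exprS le_eqVlt; apply/orP; left; apply/eqP; field.
exists (limn x); split=> // n.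
have cvd : (fun m => `|x (n + m)%N - x n|) @ \oo --> `|limn x - x n|.
  apply: cvg_norm; apply: cvgB; last exact: cvg_cst.
  rewrite (_ : (fun m => x (n + m)%N) = (fun m => x (m + n)%N)); last first.
    by apply/funext => m; rewrite addnC.
  by rewrite (cvg_shiftn n).
rewrite -(cvg_lim _ cvd)//; apply: limr_le; first exact: (cvgP _ cvd).
apply: nearW => m; apply: le_trans (dist n m) _.
by rewrite ler_piMr ?mulr_ge0 ?exprn_ge0// gerBl exprn_ge0.
Qed.

Lemma measurable_EFin d (T : measurableType d) (R : realType) (u : T -> R) :
  measurable_fun setT u -> measurable_fun setT (fun t => (u t)%:E).
Proof. by move/measurable_EFinP. Qed.

Section completeness.
Context d (T : measurableType d) (R : realType).
Variable mu : {measure set T -> \bar R}.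

Lemma measurable_L2fun_normc_sqr (f : L2fun mu) :
  measurable_fun setT (fun t => (L2abs f t ^+ 2)%:E).
Proof.
by apply: measurable_EFin; apply: measurable_funX; exact: measurable_L2abs.
Qed.

(** With [g k] the difference of two successive functions, the function
    [H = \sum_k 4 ^+ k * |g k| ^+ 2] has a finite integral. Where [H] is finite,
    [|g k| <= sqrt H * 2^-1 ^+ k], so the sequence converges there with an error
    whose square is at most [8 * 4^-1 ^+ n * H]. As this bound is infinite where
    [H] is, it can be integrated over the whole space: convergence almost
    everywhere gives convergence in norm at once. *)
Lemma L2_complete (u : nat -> L2 mu) :
  (forall k, L2norm (u k.+1 - u k) <= 4^-1 ^+ k) ->
  exists q, forall n, L2norm (q - u n) <= 4 * 2^-1 ^+ n.
Proof.
move=> uc; pose f k := repr (u k); pose g k := f k.+1 - f k.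
have gu k : L2class (g k) = u k.+1 - u k by rewrite L2classB !L2classK.
pose h k t := ((4 ^+ k * L2abs (g k) t ^+ 2)%:E : \bar R).
pose H t := (\sum_(0 <= k <oo) h k t)%E.
have h0 k t : (0 <= h k t)%E.
  by rewrite lee_fin; apply: mulr_ge0; [exact: exprn_ge0|exact: sqr_ge0].
have mh k : measurable_fun setT (h k).
  apply: measurable_EFin; apply: measurable_funM => //.
  by apply: measurable_funX; exact: measurable_L2abs.
have mH : measurable_fun setT H by exact: ge0_emeasurable_sum.
have H0 t : (0 <= H t)%E by exact: nneseries_ge0.
have intH : (\int[mu]_t H t <= 2%:E)%E.
  rewrite integral_nneseries//; apply: lime_le.
    by apply: is_cvg_nneseries => k _ _; exact: integral_ge0.
  apply: nearW => n.
  have hk k : (\int[mu]_t h k t <= (2^-1 ^+ k)%:E)%E.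
    under eq_integral do rewrite /h EFinM.
    rewrite ge0_integralZl_EFin//; first last.
    - exact: measurable_L2fun_normc_sqr.
    - by move=> t _; rewrite lee_fin sqr_ge0.
    - rewrite -L2norm_sqr gu -EFinM lee_fin.
      apply: le_trans (ler_wpM2l _ (lerXn2r 2 _ _ (uc k))) _.
      + by rewrite exprn_ge0.
      + exact: L2norm_ge0.
      + by rewrite nnegrE exprn_ge0 ?invr_ge0.
      rewrite -exprM mulnC exprM -exprMn.
      have -> : 4 * (4^-1) ^+ 2 = 4^-1 :> R by field.
      by apply: lerXn2r; rewrite ?nnegrE ?invr_ge0// lef_pV2 ?posrE// ler_nat.
  have sumE : (\sum_(0 <= k < n) (2^-1 ^+ k)%:E <= 2%:E :> \bar R)%E.
    rewrite sumEFin lee_fin.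
    suff -> : \sum_(0 <= k < n) 2^-1 ^+ k = 2 - 2 * 2^-1 ^+ n :> R.
      by rewrite gerBl mulr_ge0// exprn_ge0.
    elim: n => [|n IH]; first by rewrite big_geq// expr0 mulr1 subrr.
    by rewrite big_nat_recr//= IH exprS; field.
  by apply: le_trans sumE; apply: lee_sum => k _; exact: hk.
have key t k : (H t < +oo)%E ->
    L2abs (g k) t <= Num.sqrt (fine (H t)) * 2^-1 ^+ k.
  move=> Hoo; have Hf : H t \is a fin_num by rewrite ge0_fin_numE.
  have : (h k t <= H t)%E.
    apply: le_trans (nneseries_lim_ge k.+1 _); last by move=> *; exact: h0.
    by rewrite big_nat_recr//= leeDr// sume_ge0.
  move=> hH0; have {hH0} hH : 4 ^+ k * L2abs (g k) t ^+ 2 <= fine (H t).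
    by rewrite -lee_fin fineK.
  rewrite -(@ler_pXn2r _ 2)// ?nnegrE ?L2abs_ge0 ?mulr_ge0 ?exprn_ge0//.
  rewrite exprMn sqr_sqrtr ?fine_ge0// -exprM mulnC exprM.
  have -> : (2^-1 : R) ^+ 2 = 4^-1 by field.
  by rewrite exprVn ler_pdivlMr ?exprn_gt0// mulrC.
(* Cutting off where H is infinite makes the sequences converge everywhere. *)
pose Ar k t := if (H t < +oo)%E then complex.Re (val (f k) t) else 0.
pose Ai k t := if (H t < +oo)%E then complex.Im (val (f k) t) else 0.
pose Fr t := limn (Ar^~ t); pose Fi t := limn (Ai^~ t).
have abs_ri (z : R[i]) :
    `|complex.Re z| <= Normc.normc z /\ `|complex.Im z| <= Normc.normc z.
  have nz : 0 <= Normc.normc z by case: (z) => ? ?; exact: sqrtr_ge0.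
  by split; rewrite -(@ler_pXn2r _ 2)// ?nnegrE// real_normK ?num_real//
    normc_sqr (lerDl, lerDr) sqr_ge0.
have cvA (t : T) : [/\ Ar^~ t @ \oo --> Fr t, Ai^~ t @ \oo --> Fi t &
    forall n, ((Normc.normc ((Fr t +i* Fi t) - val (f n) t) ^+ 2)%:E <=
      (8 * 4^-1 ^+ n)%:E * H t)%E].
  have [Hoo|] := boolP (H t < +oo)%E; last first.
    rewrite -leNgt leye_eq => /eqP Ht; rewrite /Fr /Fi /Ar /Ai Ht ltxx.
    split; [exact: is_cvg_cst|exact: is_cvg_cst|move=> n].
    by rewrite gt0_muley ?leey// lte_fin mulr_gt0// exprn_gt0// invr_gt0.
  have [lr [cr br]] : exists l, Ar^~ t @ \oo --> l /\
      forall n, `|l - Ar n t| <= 2 * Num.sqrt (fine (H t)) * 2^-1 ^+ n.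
    apply: cvgn_geometric => k; rewrite /Ar Hoo; apply: le_trans (key t k Hoo).
    by rewrite -raddfB; exact: (abs_ri _).1.
  have [li [ci bi]] : exists l, Ai^~ t @ \oo --> l /\
      forall n, `|l - Ai n t| <= 2 * Num.sqrt (fine (H t)) * 2^-1 ^+ n.
    apply: cvgn_geometric => k; rewrite /Ai Hoo; apply: le_trans (key t k Hoo).
    by rewrite -raddfB; exact: (abs_ri _).2.
  rewrite /Fr /Fi (cvg_lim _ cr)// (cvg_lim _ ci)//; split=> // n.
  have Hf : H t \is a fin_num by rewrite ge0_fin_numE.
  rewrite -(fineK Hf) -EFinM lee_fin normc_sqr.
  have := br n; have := bi n; rewrite /Ar /Ai Hoo.
  set x := `|_|; set y := `|_|.
  have -> : complex.Re (lr +i* li - val (f n) t) ^+ 2 = y ^+ 2.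
    by rewrite /y real_normK ?num_real//; case: (val (f n) t).
  have -> : complex.Im (lr +i* li - val (f n) t) ^+ 2 = x ^+ 2.
    by rewrite /x real_normK ?num_real//; case: (val (f n) t).
  have sq z : 0 <= z -> z <= 2 * Num.sqrt (fine (H t)) * 2^-1 ^+ n ->
      z ^+ 2 <= 4 * 4^-1 ^+ n * fine (H t).
    move=> z0 zl; have zl0 := le_trans z0 zl.
    apply: le_trans (lerXn2r 2 _ _ zl) _;
      [by rewrite nnegrE|by rewrite nnegrE|].
    rewrite !exprMn sqr_sqrtr ?fine_ge0// -exprM mulnC exprM.
    have -> : (2^-1 : R) ^+ 2 = 4^-1 by field.
    by rewrite le_eqVlt; apply/orP; left; apply/eqP; ring.
  move=> /(sq _ (normr_ge0 _)) xb /(sq _ (normr_ge0 _)) yb.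
  have := lerD yb xb; rewrite -!mulrA.
  by set w := _ * fine _ => hw; apply: le_trans hw _; lra.
have mA : measurable_fun setT (fun t => H t < +oo)%E.
  by apply: measurable_fun_lte => //; exact: measurable_cst.
have mFr : measurable_fun setT Fr.
  apply: (@measurable_fun_cvg _ _ _ _ Ar) => [k|t _]; last by have [] := cvA t.
  by apply: measurable_fun_ifT => //; exact: measurable_L2Re.
have mFi : measurable_fun setT Fi.
  apply: (@measurable_fun_cvg _ _ _ _ Ai) => [k|t _]; last by have [] := cvA t.
  by apply: measurable_fun_ifT => //; exact: measurable_L2Im.
have mD n : measurable_fun setT (fun t =>
    ((Normc.normc ((Fr t +i* Fi t) - val (f n) t) ^+ 2)%:E : \bar R)).
  apply: measurable_EFin.
  rewrite (_ : (fun _ => _) = (fun t => (Fr t - complex.Re (val (f n) t)) ^+ 2 +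
      (Fi t - complex.Im (val (f n) t)) ^+ 2)).
    apply: measurable_funD; apply: measurable_funX;
      apply: measurable_funB => //.
      exact: measurable_L2Re.
    exact: measurable_L2Im.
  by apply/funext => t; rewrite normc_sqr; case: (val (f n) t).
have intD n :
    (\int[mu]_t (Normc.normc ((Fr t +i* Fi t) - val (f n) t) ^+ 2)%:E <=
    (16 * 4^-1 ^+ n)%:E)%E.
  apply: (@le_trans _ _ (\int[mu]_t ((8 * 4^-1 ^+ n)%:E * H t))%E).
    apply: ge0_le_integral => //.
    - by move=> t _; rewrite lee_fin sqr_ge0.
    - by apply: emeasurable_funM => //; exact: measurable_cst.
    - by move=> t _; have [_ _] := cvA t; apply.
  rewrite ge0_integralZl_EFin//.
  apply: le_trans (lee_wpmul2l _ intH) _.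
    by rewrite lee_fin mulr_ge0// exprn_ge0 ?invr_ge0.
  by rewrite -EFinM lee_fin; lra.
have D0 : (fun t => (Fr t +i* Fi t) - val (f 0%N) t) \in sqint mu.
  apply: sqintP; last by apply: le_lt_trans (intD 0%N) _; rewrite ltry.
    rewrite (_ : _ \o _ = fun t => (Fr t - complex.Re (val (f 0%N) t))).
      by apply: measurable_funB => //; exact: measurable_L2Re.
    by apply/funext => t /=; case: (val (f 0%N) t).
  rewrite (_ : _ \o _ = fun t => (Fi t - complex.Im (val (f 0%N) t))).
    by apply: measurable_funB => //; exact: measurable_L2Im.
  by apply/funext => t /=; case: (val (f 0%N) t).
pose D : L2fun mu := exist (fun v => v \in sqint mu) _ D0.
exists (L2class (D + f 0%N)) => n.
rewrite -[u n]L2classK -L2classB -(@ler_pXn2r _ 2)// ?nnegrE ?L2norm_ge0//.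
rewrite -lee_fin L2norm_sqr exprMn -exprM mulnC exprM.
have -> : (2^-1 : R) ^+ 2 = 4^-1 by field.
have -> : (4 : R) ^+ 2 = 16 by ring.
apply: le_trans (intD n); rewrite le_eqVlt; apply/orP; left; apply/eqP.
apply: eq_integral => t _; congr (_%:E); congr (_ ^+ 2).
rewrite /L2abs; congr (Normc.normc _).
have -> : val (D + f 0%N - f n) t = val D t + val (f 0%N) t - val (f n) t.
  by rewrite raddfB raddfD.
by rewrite /= subrK.
Qed.

End completeness.

(** * Density of the functions of finite level *)

Section levels.
Variable R : realType.
Notation uniform := (uniform R).

Definition level n (o : boundary) : layer n :=
  enum_rank (@Tuple n letter (mkseq o n) (introT eqP (size_mkseq o n))).

Lemma layer_word_level n o : layer_word (level n o) = mkseq o n.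
Proof. by rewrite /layer_word enum_rankK. Qed.

Lemma size_layer_word n (i : layer n) : size (layer_word i) = n.
Proof. by rewrite /layer_word size_tuple. Qed.

Lemma layer_word_inj n : injective (@layer_word n).
Proof. by move=> i j /val_inj/enum_val_inj. Qed.

Lemma level_cylinder n (i : layer n) :
  level n @^-1` [set i] = cylinder (layer_word i).
Proof.
apply/seteqP; split=> o; rewrite /cylinder/=.
  by move=> <-; rewrite size_layer_word layer_word_level.
rewrite size_layer_word => oi.
by apply: layer_word_inj; rewrite layer_word_level.
Qed.

(** A function of the first [n] letters is a function of the first [m] letters,
    for [m >= n]; a finite word is here extended by a constant letter. *)
Lemma level_coarsen n m o : (n <= m)%N ->
  level n o = level n (nth false (layer_word (level m o))).
Proof.
move=> nm; apply: layer_word_inj; rewrite !layer_word_level.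
apply: (@eq_from_nth _ false); rewrite !size_mkseq// => i ni.
by rewrite !nth_mkseq// (leq_trans ni).
Qed.

Lemma level_sum n (c : layer n -> R) o :
  c (level n o) = \sum_i c i * \1_(cylinder (layer_word i)) o.
Proof.
rewrite (bigD1 (level n o))//= big1 ?addr0 => [|i iN].
  by rewrite -level_cylinder indicE mem_set// mulr1.
rewrite -level_cylinder indicE memNset ?mulr0//= => oi.
by move: iN; rewrite oi eqxx.
Qed.

Lemma measurable_level n (c : layer n -> R) :
  measurable_fun setT (fun o => c (level n o)).
Proof.
rewrite (_ : (fun _ => _) =
    fun o => \sum_i c i * \1_(cylinder (layer_word i)) o).
  apply: measurable_sum => i; apply: measurable_funM => //.
  by apply: measurable_indic; exact: measurable_cylinder.
by apply/funext => o; exact: level_sum.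
Qed.

Lemma integral_level n (c : layer n -> R) : (forall i, 0 <= c i) ->
  (\int[uniform]_o (c (level n o))%:E)%E = (2 ^- n * \sum_i c i)%:E.
Proof.
move=> c0.
rewrite (eq_integral (fun o : boundary =>
    \sum_i (c i)%:E * (\1_(cylinder (layer_word i)) o)%:E)%E); last first.
  move=> o _; rewrite level_sum -sumEFin; apply: eq_bigr => i _.
  by rewrite EFinM.
rewrite ge0_integral_sum//; last first.
- by move=> i o _; rewrite mule_ge0// lee_fin.
- move=> i; apply: emeasurable_funM => //.
  apply: measurable_EFin; apply: measurable_indic.
  exact: measurable_cylinder.
rewrite mulr_sumr -sumEFin; apply: eq_bigr => i _.
rewrite ge0_integralZl_EFin//.
- rewrite integral_indic//; last exact: measurable_cylinder.
  transitivity ((c i)%:E * (2 ^- n)%:E)%E; last by rewrite -EFinM mulrC.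
  congr (_ * _)%E; rewrite setIT; apply: etrans (uniform_cylinder R _) _.
  by rewrite size_layer_word.
- apply: measurable_EFin; apply: measurable_indic.
  exact: measurable_cylinder.
Qed.

Definition sqdist (h g : boundary -> R) : \bar R :=
  (\int[uniform]_o ((h o - g o) ^+ 2)%:E)%E.

(** Membership in the L2-closure of the functions of finite level. *)
Definition level_approx (h : boundary -> R) : Prop :=
  measurable_fun setT h /\
  forall e : R, 0 < e -> exists n (c : layer n -> R),
    (sqdist h (fun o => c (level n o)) <= e%:E)%E.

Lemma measurable_sqdist (h g : boundary -> R) : measurable_fun setT h ->
  measurable_fun setT g -> measurable_fun setT (fun o => ((h o - g o) ^+ 2)%:E).
Proof.
move=> mh mg; apply: measurable_EFin; apply: measurable_funX.
exact: measurable_funB.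
Qed.

(** The triangle inequality for the squared distance, up to a factor 2. *)
Lemma le_sqdist2 (h g h1 g1 h2 g2 : boundary -> R) :
  measurable_fun setT h -> measurable_fun setT g ->
  measurable_fun setT h1 -> measurable_fun setT g1 ->
  measurable_fun setT h2 -> measurable_fun setT g2 ->
  (forall o, h o - g o = (h1 o - g1 o) + (h2 o - g2 o)) ->
  (sqdist h g <= 2%:E * (sqdist h1 g1 + sqdist h2 g2))%E.
Proof.
move=> mh mg mh1 mg1 mh2 mg2 e; rewrite /sqdist.
have sq0 (u v : boundary -> R) o : (0 <= ((u o - v o) ^+ 2)%:E)%E.
  by rewrite lee_fin sqr_ge0.
rewrite -ge0_integralD//; [|exact: measurable_sqdist|exact: measurable_sqdist].
rewrite -ge0_integralZl_EFin//; first last.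
- by apply: emeasurable_funD; exact: measurable_sqdist.
- by move=> o _; rewrite adde_ge0.
apply: ge0_le_integral => //.
- exact: measurable_sqdist.
- apply: emeasurable_funM => //.
  by apply: emeasurable_funD; exact: measurable_sqdist.
- move=> o _; rewrite -EFinD -EFinM lee_fin e.
  by have := sqr_ge0 ((h1 o - g1 o) - (h2 o - g2 o)); nra.
Qed.

Lemma level_approx_closed h : measurable_fun setT h ->
  (forall e : R, 0 < e -> exists2 g, level_approx g & (sqdist h g <= e%:E)%E) ->
  level_approx h.
Proof.
move=> mh H; split=> // e e0.
(* The quasi-triangle inequality doubles the sum of two errors. *)
have e4 : 0 < e / 4 by rewrite divr_gt0.
have [g [mg ga] hg] := H _ e4; have [n [c gc]] := ga _ e4; exists n, c.
have mc := measurable_level c.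
apply: le_trans (le_sqdist2 mh mc mh mg mg mc _) _.
  by move=> o; rewrite subrKA.
apply: le_trans (lee_wpmul2l _ (leeD hg gc)) _; first by rewrite lee_fin.
by rewrite -EFinD -EFinM lee_fin; lra.
Qed.

Lemma level_approxD h g : level_approx h -> level_approx g ->
  level_approx (fun o => h o + g o).
Proof.
move=> [mh ha] [mg ga]; split=> [|e e0]; first exact: measurable_funD.
have e4 : 0 < e / 4 by rewrite divr_gt0.
have [n [c hc]] := ha _ e4; have [m [k gk]] := ga _ e4.
pose N := maxn n m.
pose s (i : layer N) := c (level n (nth false (layer_word i))) +
  k (level m (nth false (layer_word i))).
have sE o : s (level N o) = c (level n o) + k (level m o).
  by rewrite /s -!level_coarsen// ?leq_maxl ?leq_maxr.
exists N, s.
apply: le_trans (le_sqdist2 (measurable_funD mh mg) (measurable_level s)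
  mh (measurable_level c) mg (measurable_level k) _) _.
  by move=> o; rewrite sE/=; ring.
apply: le_trans (lee_wpmul2l _ (leeD hc gk)) _; first by rewrite lee_fin.
by rewrite -EFinD -EFinM lee_fin; lra.
Qed.

Lemma level_approx_level n (c : layer n -> R) :
  level_approx (fun o => c (level n o)).
Proof.
split=> [|e e0]; first exact: measurable_level.
exists n, c; rewrite [sqdist _ _](_ : _ = 0%E) ?lee_fin ?ltW//.
by apply: integral0_eq => o _; rewrite subrr expr0n.
Qed.

Lemma level_approxZ (a : R) h :
  level_approx h -> level_approx (fun o => a * h o).
Proof.
move=> [mh ha]; split=> [|e e0]; first by apply: measurable_funM.
have a0 : 0 < 1 + a ^+ 2 by rewrite ltr_pwDl// sqr_ge0.
have [n [c hc]] := ha (e / (1 + a ^+ 2)) (divr_gt0 e0 a0).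
exists n, (fun i => a * c i); rewrite /sqdist.
under eq_integral do rewrite -mulrBr exprMn EFinM.
rewrite ge0_integralZl_EFin ?sqr_ge0//; last first.
- exact: measurable_sqdist (measurable_level c).
- by move=> o _; rewrite lee_fin sqr_ge0.
apply: le_trans (lee_wpmul2l _ hc) _; first by rewrite lee_fin sqr_ge0.
rewrite -EFinM lee_fin mulrCA ger_pMr// ler_pdivrMr// mul1r.
by rewrite lerDr.
Qed.

Lemma level_approx_sum (I : Type) (s : seq I) (h : I -> boundary -> R) :
  (forall i, level_approx (h i)) -> level_approx (fun o => \sum_(i <- s) h i o).
Proof.
move=> H; elim: s => [|i s IH].
  rewrite (_ : (fun _ => _) = fun=> 0).
    exact: (@level_approx_level 0 (fun=> 0)).
  by apply/funext => o; rewrite big_nil.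
rewrite (_ : (fun _ => _) = fun o => h i o + \sum_(j <- s) h j o).
  exact: level_approxD.
by apply/funext => o; rewrite big_cons.
Qed.

(** By dominated convergence, with [h ^+ 2] dominating [(h - g n) ^+ 2]. *)
Lemma level_approx_cvg (g : nat -> boundary -> R) h :
  (forall n, level_approx (g n)) -> measurable_fun setT h ->
  (forall n o, 0 <= g n o <= h o) -> (forall o, g^~ o @ \oo --> h o) ->
  (\int[uniform]_o (h o ^+ 2)%:E < +oo)%E -> level_approx h.
Proof.
move=> ga mh gh cv fh; apply: level_approx_closed => // e e0.
have mg n : measurable_fun setT (g n) by have [] := ga n.
have ih : uniform.-integrable setT (fun o => (h o ^+ 2)%:E).
  apply/integrableP; split.
    by apply: measurable_EFin; exact: measurable_funX.
  by under eq_integral do rewrite gee0_abs ?lee_fin ?sqr_ge0//.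
have mf n : measurable_fun setT (fun o => ((h o - g n o) ^+ 2)%:E).
  exact: measurable_sqdist.
have cf : {ae uniform, forall o, setT o ->
    ((h o - g n o) ^+ 2)%:E @[n --> \oo] --> (0%E : \bar R)}.
  apply: aeW => o _; apply: cvg_EFin; first exact: nearW.
  have d0 : h o - g n o @[n --> \oo] --> 0.
    by rewrite -(subrr (h o)); apply: cvgB; [exact: cvg_cst|exact: cv].
  by have := cvgM d0 d0 (FF := _); rewrite mulr0; exact.
have bf : {ae uniform, forall o n, setT o ->
    (`|((h o - g n o) ^+ 2)%:E| <= (h o ^+ 2)%:E)%E}.
  apply: aeW => o n _; rewrite gee0_abs ?lee_fin ?sqr_ge0//.
  by have /andP[] := gh n o; nra.
have [_ _] := dominated_convergence measurableT mf (measurable_cst _) cf ih bf.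
rewrite integral0 => /fine_cvgP[fX cX].
have lX := cvgr_lt 0 cX e e0.
have [n [fn ln]] := filter_ex (filterI fX (lX _)).
exists (g n) => //; have := ltW ln; rewrite -lee_fin /= fineK//.
Qed.

(** The sets determined by finitely many letters are closed under intersection
    and generate the sigma-algebra, so Dynkin's theorem applies. *)
Lemma level_approx_indic (S : set boundary) : measurable S -> level_approx \1_S.
Proof.
pose G := [set S : set boundary |
  exists n (A : set (layer n)), S = level n @^-1` A].
have int1 (B : set boundary) : measurable B ->
    (\int[uniform]_o ((\1_B o : R) ^+ 2)%:E < +oo)%E.
  move=> mB; rewrite (eq_integral (fun o => (\1_B o)%:E)); last first.
    by move=> o _; rewrite indicE; case: (_ \in _); rewrite /= ?expr1n ?expr0n.
  rewrite integral_indic// setIT.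
  apply: (@le_lt_trans _ _ 1%E); last exact: ltry.
  exact: probability_le1.
have Gm : @measurable _ boundary = <<s G >>.
  apply/seteqP; split.
    apply: sub_sigma_algebra2 => _ [w _ <-].
    exists (size w), [set i | layer_word i = w].
    by apply/seteqP; split=> o /=; rewrite layer_word_level.
  apply: smallest_sub; first exact: sigma_algebra_measurable.
  move=> _ [n [A ->]].
  have -> : level n @^-1` A = \bigcup_(i in A) (level n @^-1` [set i]).
    apply/seteqP; split=> o /= => [Ao|[i Ai /= ->]]//.
    by exists (level n o).
  apply: fin_bigcup_measurable => [|i _]; first exact: finite_finset.
  by rewrite level_cylinder; exact: measurable_cylinder.
rewrite {1}Gm; apply: (@dynkin_induction _ boundary G
  (fun B : set boundary => level_approx \1_B) Gm).
- move=> _ _ [n [A ->]] [m [B ->]]; exists (maxn n m),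
    [set i | A (level n (nth false (layer_word i))) /\
             B (level m (nth false (layer_word i)))].
  by apply/seteqP; split=> o /=; rewrite -!level_coarsen// ?leq_maxl ?leq_maxr.
- rewrite (_ : \1_setT = fun=> 1).
    exact: (@level_approx_level 0 (fun=> 1)).
  by apply/funext => o; rewrite indicT.
- move=> _ [n [A ->]].
  rewrite (_ : \1_ _ = fun o => (\1_A : _ -> R) (level n o)); last first.
    apply/funext => o; rewrite !indicE.
    suff -> : (o \in level n @^-1` A) = (level n o \in A) by [].
    by apply/idP/idP; rewrite !inE.
  exact: level_approx_level.
- move=> A mA aA.
  rewrite (_ : \1_ _ = fun o => (fun=> 1) o + (-1) * \1_A o); last first.
    by apply/funext => o; rewrite indicC indicE /=; case: (o \in A) => /=; ring.
  apply: level_approxD; last exact: level_approxZ.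
  exact: (@level_approx_level 0 (fun=> 1)).
- move=> A mA tA aA.
  have mU : measurable (\bigcup_k A k) by exact: bigcup_measurable.
  (* By disjointness a partial sum of indicators is 0 or 1 at each point. *)
  have psum o : (exists m, forall n,
        \sum_(0 <= k < n) \1_(A k) o = (m < n)%:R :> R /\ (\bigcup_k A k) o) \/
      (forall n, \sum_(0 <= k < n) \1_(A k) o = 0 :> R) /\ ~ (\bigcup_k A k) o.
    have [[m _ Amo]|nU] := pselect ((\bigcup_k A k) o); last first.
      right; split=> // n; rewrite big1// => k _.
      by rewrite indicE memNset// => Ako; apply: nU; exists k.
    left; exists m => n; split; last by exists m.
    elim: n => [|n IH]; first by rewrite big_geq.
    rewrite big_nat_recr//= IH ltnS [(m <= n)%N]leq_eqVlt indicE.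
    have [mn|mn] := eqVneq m n; last rewrite /=.
      by rewrite mn ltnn add0r mem_set// -mn.
    rewrite memNset ?addr0// => Ano; move/eqP: mn; apply.
    by apply: tA => //; exists o.
  apply: (@level_approx_cvg (fun n o => \sum_(0 <= k < n) \1_(A k) o)).
  + by move=> n; exact: level_approx_sum.
  + exact: measurable_indic.
  + move=> n o; rewrite indicE; case: (psum o) => [[m] /(_ n)[-> U]|[-> U]].
      by rewrite mem_set// ler0n lern1 leq_b1.
    by rewrite memNset// lexx.
  + move=> o; rewrite indicE; case: (psum o) => [[m hm]|[U0 U]].
      rewrite mem_set; last by have [] := hm 0%N.
      apply: cvg_near_cst; exists m.+1 => // n /= mn.
      by have [-> _] := hm n; rewrite mn.
    rewrite memNset//; apply: cvg_near_cst; apply: nearW => n; exact: U0.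
  + exact: int1.
Qed.

Lemma level_approx_nnsfun (g : {nnsfun boundary >-> R}) : level_approx g.
Proof.
rewrite (_ : (g : _ -> _) = fun o =>
    \sum_(y <- finmap.enum_fset (fset_set (range g)))
      y * \1_(g @^-1` [set y]) o).
  apply: level_approx_sum => y; apply: level_approxZ; apply: level_approx_indic.
  exact: measurable_sfunP.
by apply/funext => o; rewrite fimfunE fsbig_finite.
Qed.

Lemma level_approx_ge0 (h : boundary -> R) : measurable_fun setT h ->
  (forall o, 0 <= h o) -> (\int[uniform]_o (h o ^+ 2)%:E < +oo)%E ->
  level_approx h.
Proof.
move=> mh h0 fh.
have mh' : measurable_fun setT (EFin \o h) by exact: measurable_EFin.
pose g := nnsfun_approx measurableT mh'.
apply: (@level_approx_cvg g) => // [n|n o|o].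
- exact: level_approx_nnsfun.
- rewrite fun_ge0/= -lee_fin nnsfun_approxE.
  apply: (le_approx n (f := EFin \o h)) => // x _.
  by rewrite /= lee_fin.
- have := @cvg_nnsfun_approx _ _ _ _ measurableT _ mh' (fun x _ => h0 x) o I.
  by move=> /fine_cvgP[_]; exact.
Qed.

Lemma level_approx_sqint (h : boundary -> R) : measurable_fun setT h ->
  (\int[uniform]_o (h o ^+ 2)%:E < +oo)%E -> level_approx h.
Proof.
move=> mh fh.
have sub (u : boundary -> R) : measurable_fun setT u ->
    (forall o, 0 <= u o <= `|h o|) -> level_approx u.
  move=> mu uh; apply: level_approx_ge0 => //.
    by move=> o; case/andP: (uh o).
  apply: le_lt_trans fh; apply: ge0_le_integral => //.
  - by move=> o _; rewrite lee_fin sqr_ge0.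
  - by apply: measurable_EFin; exact: measurable_funX.
  - by apply: measurable_EFin; exact: measurable_funX.
  - move=> o _; rewrite lee_fin -(real_normK (num_real (h o))).
    by case/andP: (uh o) => u0 ul; rewrite ler_pXn2r// nnegrE.
have mn : measurable_fun setT (fun o => `|h o|) by exact: measurableT_comp.
rewrite (_ : h = fun o =>
    2^-1 * (`|h o| + h o) + (-1) * (2^-1 * (`|h o| - h o))); last first.
  by apply/funext => o; field.
apply: level_approxD; last apply: level_approxZ; apply: sub.
- by apply: measurable_funM => //; exact: measurable_funD.
- by move=> o; case: (ger0P (h o)) => ho; apply/andP; split; lra.
- by apply: measurable_funM => //; exact: measurable_funB.
- by move=> o; case: (ger0P (h o)) => ho; apply/andP; split; lra.
Qed.

End levels.

(** * The finite levels inside L2 *)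

Section steps.
Variable R : realType.
Notation uniform := (uniform R).
Notation vec n := 'cV[R[i]]_(layer_size n).

Lemma step_sqint n (v : vec n) : (fun o => v (level n o) 0) \in sqint uniform.
Proof.
apply: sqintP.
- exact: (measurable_level (fun i => complex.Re (v i 0))).
- exact: (measurable_level (fun i => complex.Im (v i 0))).
- rewrite (integral_level (c := fun i => Normc.normc (v i 0) ^+ 2)) ?ltry//.
  move=> i; exact: sqr_ge0.
Qed.

Definition step_fun n (v : vec n) : L2fun uniform :=
  exist (fun u => u \in sqint uniform) _ (step_sqint v).

(** The vectors indexed by the words of length [n], as functions in L2; up to the
    factor [2 ^- n] in the squared norm this is an isometric embedding. *)
Definition step n (v : vec n) : L2 uniform := L2class (step_fun v).

Lemma step_is_linear n : linear (@step n).
Proof.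
move=> k v w; rewrite /step -[k *: L2class _]L2classZ -L2classD.
by congr L2class; apply/val_inj/funext => o /=; rewrite !mxE.
Qed.

HB.instance Definition _ n := GRing.isLinear.Build R[i] (vec n) (L2 uniform)
  *:%R (@step n) (@step_is_linear n).

Lemma L2norm_step n (v : vec n) :
  L2norm (step v) ^+ 2 = 2 ^- n * \sum_i Normc.normc (v i 0) ^+ 2.
Proof.
apply: EFin_inj; rewrite L2norm_sqr.
apply: (integral_level (c := fun i => Normc.normc (v i 0) ^+ 2)) => i.
exact: sqr_ge0.
Qed.

(** Both representations act on functions by composition with the action, and an
    automorphism maps the first [n] letters of [o] to those of its image. *)
Lemma boundary_rep_step n (g : basilica) (v : vec n) :
  boundary_rep g (step v) =
    step (map_mx (real_complex R) (layer_rep R n g) *m v).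
Proof.
rewrite boundary_rep_class; congr L2class; apply/val_inj/funext => o /=.
rewrite mxE (bigD1 (level n (boundary_act (val g) o)))//=.
rewrite big1 ?addr0 => [|j jN].
  rewrite mxE layer_repE !layer_word_level mkseq_boundary_act eqxx.
  by rewrite rmorph1 mul1r.
rewrite mxE layer_repE layer_word_level -mkseq_boundary_act.
rewrite -layer_word_level (inj_eq (@layer_word_inj n)) eq_sym (negbTE jN).
by rewrite rmorph0 mul0r.
Qed.

Lemma L2fun_Re_Im_lty (f : L2fun uniform) :
  (\int[uniform]_o (complex.Re (val f o) ^+ 2)%:E < +oo)%E /\
  (\int[uniform]_o (complex.Im (val f o) ^+ 2)%:E < +oo)%E.
Proof.
have H (h : boundary -> R) : measurable_fun setT h ->
    (forall o, h o ^+ 2 <= L2abs f o ^+ 2) ->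
    (\int[uniform]_o (h o ^+ 2)%:E < +oo)%E.
  move=> mh hf.
  apply: (@le_lt_trans _ _ (\int[uniform]_o (L2abs f o ^+ 2)%:E)%E).
    apply: ge0_le_integral => //.
    - by move=> o _; rewrite lee_fin sqr_ge0.
    - by apply: measurable_EFin; exact: measurable_funX.
    - exact: measurable_L2fun_normc_sqr.
    - by move=> o _; rewrite lee_fin.
  by rewrite -L2norm_sqr ltry.
split; apply: H; [exact: measurable_L2Re| |exact: measurable_L2Im|];
  by move=> o; rewrite normc_sqr (lerDl, lerDr) sqr_ge0.
Qed.

(** Real and imaginary parts are approximated separately, at levels that may
    differ, and brought to a common level. *)
Lemma step_dense (q : L2 uniform) (e : R) : 0 < e ->
  exists n (v : vec n), L2norm (q - step v) <= e.
Proof.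
move=> e0; have [f ->] := L2class_surj q.
have [fr fi] := L2fun_Re_Im_lty f.
have [_ ar] := level_approx_sqint (measurable_L2Re f) fr.
have [_ ai] := level_approx_sqint (measurable_L2Im f) fi.
have e2 : 0 < e ^+ 2 / 2 by rewrite divr_gt0// exprn_gt0.
have [n [c hc]] := ar _ e2; have [m [k hk]] := ai _ e2.
pose N := maxn n m.
pose v : vec N := \col_i (c (level n (nth false (layer_word i))) +i*
  k (level m (nth false (layer_word i)))).
exists N, v; rewrite -L2classB.
rewrite -(@ler_pXn2r _ 2)// ?nnegrE ?L2norm_ge0 ?(ltW e0)//.
rewrite -lee_fin L2norm_sqr.
rewrite (eq_integral (fun o : boundary =>
    ((complex.Re (val f o) - c (level n o)) ^+ 2)%:E +
    ((complex.Im (val f o) - k (level m o)) ^+ 2)%:E)%E); last first.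
  move=> o _; rewrite -EFinD normc_sqr; congr (_%:E).
  have -> : val (f - step_fun v) o = val f o - val (step_fun v) o.
    by rewrite raddfB.
  rewrite /= mxE -!level_coarsen ?leq_maxl ?leq_maxr//.
  by case: (val f o).
rewrite ge0_integralD//.
- by have := leeD hc hk; rewrite -EFinD -splitr.
- by move=> o _; rewrite lee_fin sqr_ge0.
- by apply: measurable_sqdist; [exact: measurable_L2Re|exact: measurable_level].
- by move=> o _; rewrite lee_fin sqr_ge0.
- by apply: measurable_sqdist; [exact: measurable_L2Im|exact: measurable_level].
Qed.

End steps.

(** * Hermitian matrices away from their eigenvalues *)

Section hermitian.
Local Open Scope sesquilinear_scope.
Variables (C : numClosedFieldType) (n : nat).
Implicit Types (v : 'cV[C]_n) (M P : 'M[C]_n).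

Definition sqnorm v : C := \sum_i `|v i 0| ^+ 2.

Lemma sqnormE v : sqnorm v = (v^t* *m v) 0 0.
Proof.
by rewrite mxE; apply: eq_bigr => i _; rewrite !mxE normCKC.
Qed.

Lemma sqnorm_unitary P v : P \is unitarymx -> sqnorm (P *m v) = sqnorm v.
Proof.
move=> uP; rewrite !sqnormE trmx_mul map_mxM -mulmxA (mulmxA _ P).
by rewrite -invmx_unitary// mulVmx ?unitarymx_unit// mul1mx.
Qed.

(** In an orthonormal eigenbasis [M - z] is diagonal with entries of modulus at
    least [e]. *)
Lemma hermitian_bounded_below M (z e : C) : M \is hermsymmx -> 0 < e ->
  (forall d, d \is Num.real -> \det (d%:M - M) = 0 -> e <= `|d - z|) ->
  M - z%:M \in unitmx /\
  forall v, e ^+ 2 * sqnorm v <= sqnorm ((M - z%:M) *m v).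
Proof.
move=> hM e0 eigM.
have /orthomx_spectralP := hermitian_normalmx hM.
set P := spectralmx M; set D := spectral_diag M => ME.
have uP : P \is unitarymx by exact: spectral_unitarymx.
have Pu : P \in unitmx by exact: unitarymx_unit.
have D1 (k : C) : invmx P *m k%:M *m P = k%:M.
  by rewrite mul_mx_scalar -scalemxAl mulVmx// scalemx1.
have gap i : e <= `|D 0 i - z|.
  apply: eigM; first by have /mxOverP := hermitian_spectral_diag_real hM; apply.
  rewrite [in LHS]ME -(D1 (D 0 i)) -mulmxBl -mulmxBr !det_mulmx.
  rewrite (_ : (D 0 i)%:M - diag_mx D = diag_mx (\row_j (D 0 i - D 0 j))).
    rewrite det_diag (bigD1 i)//= mxE subrr mul0r.
    by rewrite mulr0 mul0r.
  apply/matrixP => j k; rewrite !mxE.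
  by case: eqVneq => [->|]; rewrite ?mulr1n ?mulr0n ?subr0.
have MzE : M - z%:M = invmx P *m diag_mx (\row_j (D 0 j - z)) *m P.
  rewrite -(D1 z) {1}ME -mulmxBl -mulmxBr; congr (_ *m _ *m _).
  apply/matrixP => j k; rewrite !mxE.
  by case: eqVneq => [->|]; rewrite ?mulr1n ?mulr0n ?subr0.
split.
  rewrite MzE !unitmx_mul unitmx_inv Pu andbT/= unitmxE det_diag unitfE.
  apply/prodf_neq0 => i _; rewrite mxE -normr_gt0.
  exact: lt_le_trans (gap i).
move=> v; rewrite MzE -!mulmxA invmx_unitary//.
rewrite sqnorm_unitary ?trmxC_unitary// -(sqnorm_unitary v uP).
rewrite /sqnorm mulr_sumr; apply: ler_sum => i _.
set w := P *m v; rewrite mul_diag_mx !mxE normrM exprMn.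
apply: ler_wpM2r; first by rewrite exprn_ge0.
by rewrite ler_pXn2r ?nnegrE// ltW.
Qed.

End hermitian.

(** * The spectrum of the sum of the generators *)

Lemma geometric_le (R : realType) (c d : R) : 0 <= c -> 0 < d ->
  exists k, c * 2^-1 ^+ k <= d.
Proof.
move=> c0 d0; have := archi_boundP (divr_ge0 c0 (ltW d0)).
set k := Num.bound _ => ck; exists k.
rewrite exprVn ler_pdivrMr ?exprn_gt0// -ler_pdivrMl// mulrC.
by rewrite (le_trans (ltW ck))// -natrX ler_nat ltnW// ltn_expl.
Qed.

Section operator.
Variable R : realType.
Notation uniform := (uniform R).
Notation vec n := 'cV[R[i]]_(layer_size n).
Implicit Types (q p : L2 uniform).

Definition gens_op q : L2 uniform := \sum_(s <- gens) boundary_rep s q.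

Lemma gens_op_is_linear : linear gens_op.
Proof.
move=> k q p; rewrite /gens_op scaler_sumr -big_split/=.
by apply: eq_bigr => s _; rewrite linearP.
Qed.

HB.instance Definition _ := GRing.isLinear.Build R[i] (L2 uniform) (L2 uniform)
  *:%R gens_op gens_op_is_linear.

Lemma gens_opE q : gens_op q =
  boundary_rep gen_a q + boundary_rep gen_a^-1%g q +
  (boundary_rep gen_b q + boundary_rep gen_b^-1%g q).
Proof. by rewrite /gens_op !big_cons big_nil addr0 -!addrA. Qed.

Lemma L2norm_boundary_rep g q : L2norm (boundary_rep g q) = L2norm q.
Proof. by have := norm_boundary_rep g q; rewrite !L2_normE => /complexI. Qed.

Lemma L2norm_gens_op q : L2norm (gens_op q) <= 4 * L2norm q.
Proof.
rewrite gens_opE; apply: le_trans (L2norm_triangle _ _) _.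
have := L2norm_triangle (boundary_rep gen_a q) (boundary_rep gen_a^-1%g q).
have := L2norm_triangle (boundary_rep gen_b q) (boundary_rep gen_b^-1%g q).
by rewrite !L2norm_boundary_rep; lra.
Qed.

Definition gens_mx n : 'M[R]_(layer_size n) :=
  \sum_(s <- gens) layer_rep R n s.

Lemma gens_mxE n : gens_mx n = layer_rep R n gen_a + layer_rep R n gen_a^-1%g +
  (layer_rep R n gen_b + layer_rep R n gen_b^-1%g).
Proof. by rewrite /gens_mx !big_cons big_nil addr0 -!addrA. Qed.

Lemma gens_op_step n (v : vec n) :
  gens_op (step v) = step (map_mx (real_complex R) (gens_mx n) *m v).
Proof.
rewrite gens_opE gens_mxE !map_mxD !mulmxDl !linearD/=.
by rewrite !boundary_rep_step.
Qed.

Lemma layer_repV n (g : basilica) : layer_rep R n g^-1%g = (layer_rep R n g)^T.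
Proof.
apply/matrixP => i j; rewrite [RHS]mxE !layer_repE; congr (nat_of_bool _)%:R.
apply/eqP/eqP => [<-|<-] /=.
  exact: (aut_invK (val g)).
exact: (aut_funK (val g)).
Qed.

Lemma gens_mx_sym n : (gens_mx n)^T = gens_mx n.
Proof.
rewrite gens_mxE !layer_repV !linearD/= !trmxK.
by rewrite [X in X + _]addrC [X in _ + X]addrC.
Qed.

Lemma Q_quarter n (lam : R) :
  Q n (lam, - 4^-1, - 4^-1) = \det (lam%:M - 4^-1 *: gens_mx n).
Proof.
rewrite /Q gens_mxE; congr (\det _).
by rewrite !scaleNr [in RHS]scalerDr opprD addrA.
Qed.

Lemma gens_mx_eigen n (d : R) : \det (d%:M - gens_mx n) = 0 ->
  Q n (4^-1 * d, - 4^-1, - 4^-1) = 0.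
Proof.
by move=> d0; rewrite Q_quarter -scale_scalar_mx -scalerBr detZ d0 mulr0.
Qed.

Lemma sqnorm_step n (v : vec n) :
  ((L2norm (step v)) ^+ 2)%:C = (2 ^- n)%:C * sqnorm v.
Proof.
rewrite L2norm_step rmorphM; congr (_ * _).
by rewrite rmorph_sum; apply: eq_bigr => i _; rewrite rmorphXn.
Qed.

(** A gap that is uniform in the level: this is what lets the resolvents of the
    finite levels converge. *)
Definition spectral_gap (z : R[i]) (e : R) := forall n (lam : R),
  Q n (lam, - 4^-1, - 4^-1) = 0 -> e <= Normc.normc (4^-1 * z - lam%:C).

Lemma linear_boundedC (B : {linear L2 uniform -> L2 uniform}) :
  continuous B <-> exists c : R, forall q, L2norm (B q) <= c * L2norm q.
Proof.
rewrite -linear_bounded_continuous linear_boundedP; split.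
  move=> [r [rr rB]]; have rr1 : r < r + 1 by rewrite ltrDl.
  have /complex_realP[c rc] : r + 1 \is Num.real by rewrite realD.
  exists c => q; have := rB _ rr1 q.
  by rewrite !L2_normE rc -rmorphM lecR.
move=> [c cB]; exists c%:C; split; first by apply/complex_realP; exists c.
move=> r cr q; apply: (@le_trans _ _ (c%:C * `|q|)).
  by rewrite !L2_normE -rmorphM lecR.
by apply: ler_wpM2r => //; exact: ltW.
Qed.

Section resolvent.
Variables (z : R[i]) (e : R).
Hypotheses (e0 : 0 < e) (gap : spectral_gap z e).

Definition shift_op q : L2 uniform := gens_op q - z *: q.

Lemma shift_op_is_linear : linear shift_op.
Proof.
move=> k q p; rewrite /shift_op linearP/= scalerBr scalerDr opprD.
by rewrite scalerA [z * k]mulrC -scalerA addrACA.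
Qed.

HB.instance Definition _ := GRing.isLinear.Build R[i] (L2 uniform) (L2 uniform)
  *:%R shift_op shift_op_is_linear.

Lemma L2norm_shift_op q : L2norm (shift_op q) <= (4 + Normc.normc z) * L2norm q.
Proof.
apply: le_trans (L2norm_triangle _ _) _.
by rewrite L2normN L2norm_scale mulrDl lerD2r L2norm_gens_op.
Qed.

Let M n := map_mx (real_complex R) (gens_mx n).

Lemma shift_op_step n (v : vec n) :
  shift_op (step v) = step ((M n - z%:M) *m v).
Proof.
rewrite /shift_op gens_op_step -[z *: step v]linearZ -linearB.
by rewrite -mul_scalar_mx -mulmxBl.
Qed.

Lemma gens_mx_gap n : M n - z%:M \in unitmx /\
  forall v : vec n, ((4 * e)%:C) ^+ 2 * sqnorm v <= sqnorm ((M n - z%:M) *m v).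
Proof.
apply: hermitian_bounded_below; last 2 first.
- by rewrite ltcR mulr_gt0.
- move=> d /complex_realP[k ->] dM.
  have /gens_mx_eigen/gap : \det (k%:M - gens_mx n) = 0.
    apply: complexI; rewrite -det_map_mx rmorph0 -[RHS]dM; congr (\det _).
    by rewrite map_mxB map_scalar_mx.
  rewrite rmorphM/= (_ : _ - _ = (4^-1)%:C * (z - k%:C)); last first.
    by rewrite mulrBr fmorphV/= rmorph_nat.
  rewrite Normc.normcM distrC.
  have -> : Normc.normc (4^-1)%:C = 4^-1 :> R.
    by rewrite /= expr0n addr0 sqrtr_sqr ger0_norm// invr_ge0.
  rewrite -(ler_pM2l (ltr0n R 4)) mulrA divff// mul1r => h.
  by rewrite -[X in _ <= X]/((Normc.normc (z - k%:C))%:C) lecR.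
- apply: realsym_hermsym.
    apply/is_hermitianmxP; rewrite expr0 scale1r map_mx_id//.
    by rewrite /M map_trmx gens_mx_sym.
  apply/mxOverP => i j; rewrite mxE; apply/complex_realP.
  by exists (gens_mx n i j).
Qed.

(** The lower bound holds on all finite levels with the same constant, hence on
    their closure, as the operator is continuous. *)
Lemma shift_op_bounded_below q : 4 * e * L2norm q <= L2norm (shift_op q).
Proof.
have e4 : 0 < 4 * e by rewrite mulr_gt0.
have z0 : 0 <= Normc.normc z by case: (z) => ? ?; exact: sqrtr_ge0.
have stepb n (v : vec n) :
    4 * e * L2norm (step v) <= L2norm (shift_op (step v)).
  rewrite -(@ler_pXn2r _ 2)// ?nnegrE ?mulr_ge0 ?L2norm_ge0 ?(ltW e0)//.
  rewrite -lecR exprMn rmorphM/= shift_op_step !sqnorm_step mulrCA.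
  rewrite rmorphXn; apply: ler_wpM2l; last exact: (gens_mx_gap n).2.
  by rewrite lecR invr_ge0 exprn_ge0.
apply/ler_addgt0Pl => d d0.
pose c := 4 * e + (4 + Normc.normc z).
have c0 : 0 < c by rewrite /c; lra.
have [n [v qv]] := step_dense q (divr_gt0 d0 c0).
have h1 : L2norm q <= L2norm (q - step v) + L2norm (step v).
  by have := L2norm_triangle (q - step v) (step v); rewrite subrK.
have h2 : L2norm (shift_op (step v)) <=
    L2norm (shift_op q) + (4 + Normc.normc z) * L2norm (q - step v).
  have := L2norm_triangle (shift_op q) (shift_op (step v) - shift_op q).
  rewrite [_ + (_ - _)]addrC subrK => /le_trans; apply.
  by rewrite lerD2l -linearB L2norm_distC -?linearB; exact: L2norm_shift_op.
have h3 := stepb n v.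
have h4 : c * L2norm (q - step v) <= d.
  by rewrite mulrC -ler_pdivlMr.
have h5 : 4 * e * L2norm q <= 4 * e * (L2norm (q - step v) + L2norm (step v)).
  by apply: ler_wpM2l => //; exact: ltW.
move: h4; rewrite /c => h4; lra.
Qed.

Lemma shift_op_inj : injective shift_op.
Proof.
move=> q p qp; apply/eqP; rewrite -subr_eq0; apply/eqP/L2norm_eq0/eqP.
rewrite eq_le L2norm_ge0 andbT.
have := shift_op_bounded_below (q - p); rewrite linearB/= qp subrr L2norm0.
by rewrite pmulr_rle0// mulr_gt0.
Qed.

(** The equation is solved on finite levels for a fast sequence of approximations
    of [q]; by the lower bound the solutions form a fast Cauchy sequence. *)
Lemma shift_op_surj q : exists p, shift_op p = q.
Proof.
have e4 : 0 < 4 * e by rewrite mulr_gt0.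
have z0 : 0 <= Normc.normc z by case: (z) => ? ?; exact: sqrtr_ge0.
have dk k : 0 < 2 * e * 4^-1 ^+ k by rewrite !mulr_gt0// exprn_gt0// invr_gt0.
have ex k : exists u, L2norm (q - shift_op u) <= 2 * e * 4^-1 ^+ k.
  have [n [w qw]] := step_dense q (dk k).
  exists (step (invmx (M n - z%:M) *m w)).
  by rewrite shift_op_step mulKVmx//; exact: (gens_mx_gap n).1.
have [u uq] := choice ex.
have [k|p pu] := @L2_complete _ _ _ uniform u.
  rewrite -(ler_pM2l e4); apply: le_trans (shift_op_bounded_below _) _.
  rewrite linearB/=; apply: le_trans (L2norm_dist _ _ q) _.
  rewrite L2norm_distC; have := uq k; have := uq k.+1.
  have : 0 <= e * 4^-1 ^+ k by rewrite mulr_ge0 ?ltW// exprn_gt0.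
  by rewrite exprS; nra.
exists p; apply: L2norm_small_eq => d d0.
pose c := (4 + Normc.normc z) * 4 + 2 * e.
have c0 : 0 <= c by rewrite /c; lra.
have [k ck] := geometric_le c0 d0; apply: le_trans ck.
apply: le_trans (L2norm_dist _ _ (shift_op (u k))) _.
rewrite -linearB [X in _ + X]L2norm_distC /c mulrDl; apply: lerD.
  apply: le_trans (L2norm_shift_op _) _.
  by rewrite -mulrA; apply: ler_wpM2l (pu k); lra.
apply: le_trans (uq k) _; apply: ler_wpM2l; first lra.
by apply: lerXn2r; rewrite ?nnegrE ?invr_ge0// lef_pV2 ?posrE// ler_nat.
Qed.

Lemma resolvent_exists : exists B : {linear L2 uniform -> L2 uniform},
  [/\ continuous B, forall q, B (shift_op q) = q &
      forall q, shift_op (B q) = q].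
Proof.
have [b shiftK] := choice shift_op_surj.
have bK : cancel shift_op b by move=> q; apply: shift_op_inj; rewrite shiftK.
have lb : linear b.
  by move=> k q p; apply: shift_op_inj; rewrite linearP/= !shiftK.
pose B : {linear L2 uniform -> L2 uniform} :=
  HB.pack b (GRing.isLinear.Build _ _ _ _ b lb).
exists B; split=> //; apply/linear_boundedC; exists (4 * e)^-1 => q.
rewrite mulrC ler_pdivlMr ?mulr_gt0// mulrC.
by rewrite -{2}(shiftK q); exact: shift_op_bounded_below.
Qed.

End resolvent.

Lemma spectral_gap_notin (z : R[i]) (e : R) : 0 < e -> spectral_gap z e ->
  ~ spectrum gens_op z.
Proof.
move=> e0 gap; apply.
by have [B [cB BK KB]] := resolvent_exists e0 gap; exists B.
Qed.

Lemma Q_iter n m (p : R * R * R) : Q (n + m) p = Q m (iter n (@F R) p).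
Proof. by elim: n p => [|n IH] p //; rewrite addSn Q_rec IH iterSr. Qed.

(** If [z / 4] is not real, its imaginary part is a gap, as [lam] ranges over
    the reals; otherwise a ball around the point outside [K] gives one. *)
Lemma spectrum_sub_K z : spectrum gens_op z ->
  exists2 lam : R, K (lam, - 4^-1, - 4^-1) & lam%:C = 4^-1 * z.
Proof.
move=> zs; apply: contrapT => noK.
suff [e e0 gap] : exists2 e, 0 < e & spectral_gap z e.
  exact: (spectral_gap_notin e0 gap).
set w := 4^-1 * z in noK *.
have [im0|im0] := eqVneq (complex.Im w) 0; last first.
  exists `|complex.Im w|; first by rewrite normr_gt0.
  move=> n lam _.
  rewrite -(@ler_pXn2r _ 2)// ?nnegrE//; last first.
    by case: (_ - _) => ? ?; exact: sqrtr_ge0.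
  rewrite normc_sqr real_normK ?num_real//.
  have -> : complex.Im (w - lam%:C) = complex.Im w.
    by case: (w) => a b /=; rewrite subr0.
  by rewrite lerDr sqr_ge0.
have wE : w = (complex.Re w)%:C by case: (w) im0 => x y /= ->.
have nK : ~ K (complex.Re w, - 4^-1, - 4^-1).
  by move=> wK; apply: noK; exists (complex.Re w).
have [e e0 eK] : exists2 e : R, 0 < e & forall p : R * R * R,
    ball ((complex.Re w, - 4^-1, - 4^-1) : R * R * R) e p ->
    ~ (\bigcup_n (iter n (@F R) @^-1` [set p | Q 1 p = 0])) p.
  apply: contrapT => H; apply: nK => A /nbhs_ballP[e /= e0 eA].
  apply: contrapT => AK; apply: H; exists e => // p /eA Ap pU.
  by apply: AK; exists p.
exists e => // n lam Q0; rewrite leNgt; apply/negP => lt.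
apply: (eK (lam, - 4^-1, - 4^-1)).
  split; last exact: ballxx.
  split; last exact: ballxx.
  apply: le_lt_trans lt.
  have -> : 4^-1 * z - lam%:C = (complex.Re w - lam)%:C.
    by rewrite -/w {1}wE rmorphB.
  by rewrite /= expr0n addr0 sqrtr_sqr.
case: n Q0 => [|n] Q0.
  by exists 0%N => //; rewrite /preimage /mkset Q1E Q0 mul0r.
by exists n => //; rewrite /preimage /mkset -Q_iter addn1.
Qed.

(** A vanishing determinant gives a vector in the kernel of the symmetric matrix
    at level [n], which becomes a function of level [n]. *)
Lemma Q_eigenvector n (l m v : R) : Q n (l, m, v) = 0 ->
  exists2 q : L2 uniform, q != 0 &
    l%:C *: q + m%:C *: (boundary_rep gen_a q + boundary_rep gen_a^-1%g q) +
      v%:C *: (boundary_rep gen_b q + boundary_rep gen_b^-1%g q) = 0.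
Proof.
rewrite /Q; set X := _ + _ + _ => /eqP; rewrite -det_tr => /det0P[x x0 xX].
exists (step (map_mx (real_complex R) x^T)).
  apply: contra_neq x0 => /(congr1 (fun q => L2norm q ^+ 2)).
  rewrite L2norm_step L2norm0 expr0n/= => /eqP.
  rewrite mulf_eq0 invr_eq0 expf_eq0/= pnatr_eq0 andbF /=.
  rewrite psumr_eq0; last by move=> i _; exact: sqr_ge0.
  move=> /allP xz; apply/rowP => i; rewrite [RHS]mxE; apply/eqP.
  have := xz i; rewrite mem_index_enum => /(_ isT).
  by rewrite normc_sqr !mxE /= expr0n addr0 sqrf_eq0.
rewrite !boundary_rep_step -!linearD/= -!linearZ/= -!linearD/=.
rewrite -!mulmxDl -mul_scalar_mx !scalemxAl -!mulmxDl -!map_mxD -!map_mxZ.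
rewrite -map_scalar_mx -!map_mxD -map_mxM -/X -[X]trmxK -trmx_mul xX.
by rewrite trmx0 map_mx0 linear0.
Qed.

Lemma L2norm_scaleR (k : R) q : L2norm (k%:C *: q) = `|k| * L2norm q.
Proof. by rewrite L2norm_scale /= expr0n addr0 sqrtr_sqr. Qed.

(** Adding 4 times the given vanishing combination to [A - 4 lam] leaves the
    coefficients [4 (l - lam)], [4 (m + 1/4)] and [4 (v + 1/4)]. *)
Lemma L2norm_perturb (l m v lam : R) q :
  l%:C *: q + m%:C *: (boundary_rep gen_a q + boundary_rep gen_a^-1%g q) +
    v%:C *: (boundary_rep gen_b q + boundary_rep gen_b^-1%g q) = 0 ->
  L2norm (gens_op q - (4 * lam%:C) *: q) <=
    (4 * `|lam - l| + 8 * `|- 4^-1 - m| + 8 * `|- 4^-1 - v|) * L2norm q.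
Proof.
set ra := boundary_rep gen_a q + _; set rb := boundary_rep gen_b q + _ => q0.
have -> : gens_op q - (4 * lam%:C) *: q =
    (4 * (l - lam))%:C *: q + (4 * (m + 4^-1))%:C *: ra +
    (4 * (v + 4^-1))%:C *: rb.
  have -> : gens_op q = ra + rb by rewrite gens_opE.
  transitivity (ra + rb - (4 * lam%:C) *: q +
      4 *: (l%:C *: q + m%:C *: ra + v%:C *: rb)).
    by rewrite q0 scaler0 addr0.
  have e1 : (4 * (l - lam))%:C = 4 * l%:C - 4 * lam%:C.
    by rewrite rmorphM rmorphB rmorph_nat mulrBr.
  have e2 (k : R) : (4 * (k + 4^-1))%:C = 1 + 4 * k%:C.
    have -> : 4 * (k + 4^-1) = 1 + 4 * k by field.
    by rewrite rmorphD rmorphM rmorph_nat rmorph1.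
  have rearrange (k a b c s : R[i]) (x y w : L2 uniform) :
      x + y - s *: w + k *: (a *: w + b *: x + c *: y) =
      (k * a - s) *: w + (1 + k * b) *: x + (1 + k * c) *: y.
    rewrite scalerBl !scalerDl !scale1r !scalerDr !scalerA.
    by rewrite [RHS](AC (2*2*2) ((3*5*2)*(1*4*6))).
  by rewrite e1 !e2 rearrange.
have tri (x y : L2 uniform) : L2norm (x + y) <= 2 * L2norm q ->
    forall k, L2norm (k%:C *: (x + y)) <= `|k| * (2 * L2norm q).
  by move=> xy k; rewrite L2norm_scaleR ler_wpM2l.
have two g : L2norm (boundary_rep g q + boundary_rep g^-1%g q) <= 2 * L2norm q.
  apply: le_trans (L2norm_triangle _ _) _.
  by rewrite !L2norm_boundary_rep; lra.
apply: le_trans (L2norm_triangle _ _) _.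
rewrite [X in _ <= X]mulrDl; apply: lerD; last first.
  apply: le_trans (tri _ _ (two gen_b) _) _.
  by rewrite normrM ger0_norm// -opprD normrN [v + _]addrC; lra.
apply: le_trans (L2norm_triangle _ _) _.
rewrite [X in _ <= X]mulrDl; apply: lerD; last first.
  apply: le_trans (tri _ _ (two gen_a) _) _.
  by rewrite normrM ger0_norm// -opprD normrN [m + _]addrC; lra.
by rewrite L2norm_scaleR normrM ger0_norm// distrC.
Qed.

Lemma K_sub_spectrum (lam : R) : K (lam, - 4^-1, - 4^-1) ->
  spectrum gens_op (4 * lam%:C).
Proof.
move=> lamK [B [cB BK _]].
have [c cq] := (linear_boundedC B).1 cB.
have c0 : 0 < 1 + `|c| by rewrite ltr_pwDl.
(* 20 is the sum of the coefficients 4, 8 and 8 of L2norm_perturb. *)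
pose d := (20 * (1 + `|c|))^-1.
have d0 : 0 < d by rewrite invr_gt0 mulr_gt0.
have [[[l m] v] [[n _ nU] [[/= lb mb] vb]]] := lamK _ (nbhsx_ballx _ _ d0).
have Q0 : Q n.+1 (l, m, v) = 0 by rewrite -addn1 Q_iter.
have [q q0 qE] := Q_eigenvector Q0.
have qgt0 : 0 < L2norm q.
  rewrite lt_neqAle L2norm_ge0 andbT eq_sym; apply: contra_neq q0.
  exact: L2norm_eq0.
have small : L2norm (gens_op q - (4 * lam%:C) *: q) <= 20 * d * L2norm q.
  apply: le_trans (L2norm_perturb lam qE) _; apply: ler_wpM2r; first exact: ltW.
  move: lb mb vb; rewrite /ball/= => lb mb vb; lra.
have := cq (gens_op q - (4 * lam%:C) *: q); rewrite BK leNgt => /negP; apply.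
apply: le_lt_trans (ler_norm _) _; rewrite normrM (ger0_norm (L2norm_ge0 _)).
apply: le_lt_trans (ler_wpM2l (normr_ge0 c) small) _.
rewrite mulrA -[X in _ < X]mul1r ltr_pM2r//.
have -> : 20 * d = (1 + `|c|)^-1.
  by rewrite /d invfM mulrA divff ?mul1r// pnatr_eq0.
by rewrite ltr_pdivrMr// mul1r ltrDr.
Qed.

End operator.

Theorem proposition4p1 (R : realType) :
  [/\ forall lam mu nu : R,
        Q 0 (lam, mu, nu) = lam + 2 * mu + 2 * nu,
      forall lam mu nu : R,
        Q 1 (lam, mu, nu) = Q 0 (lam, mu, nu) * (lam - 2 * mu + 2 * nu),
      forall (n : nat) (p : R * R * R), (1 <= n)%N -> Q n.+1 p = Q n (F p) &
      rep_spectrum (@boundary_rep R) gens =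
        [set lam%:C | lam in [set lam : R | K (lam, - 4^-1, - 4^-1)]]].
Proof.
split; [exact: Q0E|exact: Q1E|by move=> n p _; exact: Q_rec|].
have four : (size gens)%:R = 4 :> R[i] by [].
apply/seteqP; split=> [_ [z zs <-]|_ [lam lamK <-]].
  by have [lam lamK lamE] := spectrum_sub_K zs; exists lam; rewrite ?four.
exists (4 * lam%:C); first exact: K_sub_spectrum.
by rewrite four mulrA mulVf ?mul1r// pnatr_eq0.
Qed.
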